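(* Let $|q|<1$ and $|r|<1$. The polynomials orthogonal with respect to the Rogers density $f_R(x|r,q)$ are the monic Rogers polynomials $\{w_n(x|r,q)\}_{n\ge-1}$ satisfying $w_{-1}=0$, $w_0=1$ and, for $n\ge0$, $$x\,w_n(x|r,q)=w_{n+1}(x|r,q)+[n]_q\frac{1-r^2q^{n-1}}{(1-rq^{n-1})(1-rq^n)}w_{n-1}(x|r,q).$$ One has $w_n(x|r,q)=P_n(x|x,r,q)/(r)_n$. Moreover, for $n,m\ge0$, $$\int_{S(q)}w_n(x|r,q)w_m(x|r,q)f_R(x|r,q)\,dx=\begin{cases}0&\text{if }n\ne m,\\ [n]_q!\,\dfrac{(1-r)(r^2)_n}{(r)_n(r)_{n+1}}&\text{if }m=n.\end{cases}$$
   Context: For $|q|<1$ let $S(q)=[-2/\sqrt{1-q},2/\sqrt{1-q}]$, $[0]_q=0$, $[n]_q=1+q+\dots+q^{n-1}$ for $n\ge1$, $[0]_q!=1$, $[n]_q!=\prod_{i=1}^n[i]_q$; $(a)_0=1$, $(a)_j=\prod_{k=1}^j(1-aq^{k-1})$, $(a)_\infty=\prod_{k=0}^\infty(1-aq^k)$. With $l_q(x|a)=(1+a)^2-(1-q)ax^2$, define for $x\in S(q)$ $$f_N(x|q)=\frac{(q)_\infty\sqrt{1-q}\sqrt{4-(1-q)x^2}}{2\pi}\prod_{i=1}^\infty l_q(x|q^i),\qquad f_R(x|\beta,q)=f_N(x|q)\frac{(\beta^2)_\infty}{(\beta)_\infty(\beta q)_\infty\prod_{i=0}^\infty l_q(x|\beta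 q^i)}\quad(|\beta|<1).$$ The Al-Salam--Chihara polynomials $P_n(x|y,\rho,q)$ are defined by $P_{-1}=0$, $P_0=1$ and $$P_{n+1}(x|y,\rho,q)=(x-\rho yq^n)P_n(x|y,\rho,q)-(1-\rho^2q^{n-1})[n]_qP_{n-1}(x|y,\rho,q);$$ $P_n(x|x,r,q)$ is obtained by setting $y=x$, $\rho=r$. (The term with $w_{-1}$ or $P_{-1}$ at $n=0$ is zero.) *)

(* Defs.v *)
From HB Require Import structures.
From mathcomp Require Import all_boot all_order all_algebra.
From mathcomp Require Import all_classical all_reals all_analysis.
Import Order.TTheory GRing.Theory Num.Theory.
Import numFieldNormedType.Exports.

Set Implicit Arguments.
Unset Strict Implicit.
Unset Printing Implicit Defensive.

Local Open Scope classical_set_scope.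
Local Open Scope ring_scope.

Section Rogers.
Context {R : realType}.
Implicit Types (q r a rho x y : R) (n : nat).

Definition qint q n : R := \sum_(i < n) q ^+ i.

Definition qfact q n : R := \prod_(1 <= i < n.+1) qint q i.

(* [q ^+ 0 = 1] also for [q = 0]. *)
Definition qpoch a q n : R := \prod_(k < n) (1 - a * q ^+ k).

(* Limit of the partial products; [limn] is an arbitrary point when that
   limit does not exist. For |q| < 1 all the products below do converge. *)
Definition infprod (u : nat -> R) : R := limn (fun n => \prod_(k < n) u k).

Definition qpoch_inf a q : R := infprod (fun k => 1 - a * q ^+ k).

Definition Sq q : set R :=
  `[- (2 / Num.sqrt (1 - q)), 2 / Num.sqrt (1 - q)].

Definition lq q x a : R := (1 + a) ^+ 2 - (1 - q) * a * x ^+ 2.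

Definition fN q x : R :=
  qpoch_inf q q * Num.sqrt (1 - q) * Num.sqrt (4 - (1 - q) * x ^+ 2)
  / (2 * pi) * infprod (fun i => lq q x (q ^+ i.+1)).

Definition fR b q x : R :=
  fN q x * (qpoch_inf (b ^+ 2) q
            / (qpoch_inf b q * qpoch_inf (b * q) q
               * infprod (fun i => lq q x (b * q ^+ i)))).

(* Polynomial in the first argument x of P_n(x|y,rho,q), with y fixed. In both
   recursions below, the inner [match] makes the term of index -1 vanish. *)
Fixpoint ASC y rho q n : {poly R} :=
  match n with
  | 0 => 1
  | k.+1 =>
      ('X - (rho * y * q ^+ k)%:P) * ASC y rho q k
      - match k with
        | 0 => 0
        | j.+1 => ((1 - rho ^+ 2 * q ^+ j) * qint q k) *: ASC y rho q j
        end
  end.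

(* x w_n = w_(n+1) + [n]_q (1 - r^2 q^(n-1))
                     / ((1 - r q^(n-1)) (1 - r q^n)) w_(n-1),
   solved for w_(n+1). *)
Fixpoint rogers r q n : {poly R} :=
  match n with
  | 0 => 1
  | k.+1 =>
      'X * rogers r q k
      - match k with
        | 0 => 0
        | j.+1 =>
            (qint q k * ((1 - r ^+ 2 * q ^+ j)
                         / ((1 - r * q ^+ j) * (1 - r * q ^+ k))))
            *: rogers r q j
        end
  end.

(* The equality to [0%:E] takes place in the extended reals, so it also says
   that the integral is finite. *)
Definition monic_orthogonal (D : set R) (f : R -> R) (p : nat -> {poly R}) :=
  (forall n, p n \is monic /\ size (p n) = n.+1) /\
  (forall n m, n <> m ->
    (\int[lebesgue_measure]_(x in D) ((p n).[x] * (p m).[x] * f x)%:E = 0)%E).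

End Rogers.

(* Main.v *)
Require Import Defs.
From HB Require Import structures.
From mathcomp Require Import all_boot all_order all_algebra.
From mathcomp Require Import all_classical all_reals all_analysis.
From mathcomp Require Import measurable_realfun ring lra.
Import Order.TTheory GRing.Theory Num.Theory.
Import numFieldNormedType.Exports.

Local Open Scope classical_set_scope.
Local Open Scope ring_scope.

(** Let L_r(p) be the integral of p(x) f_R(x|r,q) over S(q). Everything comes
    down to L_r(w_n) = [n = 0]: the three-term recurrence then gives all the
    integrals of w_n w_m ([moment_rogersM]), and because the resulting squared
    norms do not vanish and the w_n form a basis, a monic orthogonal family has
    to be the w_n ([monic_orthogonal_rogers]). The formula with the
    Al-Salam--Chihara polynomials only compares two recurrences.

    To compute L_r(w_n), compare the parameters s and s q. The density
    f_R(x|sq,q) is a constant multiple of l_q(x|s) f_R(x|s,q) ([fR_dilate]).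
    On the other side, after a rescaling E_n of w_n by a constant, a Christoffel
    type identity holds ([nrogers_contiguous]): l_q(x|s) E_n(x|sq) is a multiple
    of E_n(x|s) - s E_{n+2}(x|s). Hence the defects
    d(s,n) = L_s(E_n(.|s)) - [n = 0] satisfy
      d(s,n) - s d(s,n+2) = (1 - s q^{n+1}) / (1 - s q) d(sq,n).

    At s = q all infinite products cancel: the density is a semicircle and E_n
    is a Chebyshev polynomial of the second kind, so d(q,.) = 0
    ([integral_nrogers_q]). The relation passes this on to q^2, q^3, ..., and
    continuity at 0 yields d(0,.) = 0; the quantitative form of continuity is then
    |d(s,n)| <= C (n+1) |s| for |s| <= |r|. Read from s q to s, the relation is
    solved by a contraction in a weighted supremum norm, and bounds grow only by
    a factor 1 + O(|s|). Climbing from r q^N to r therefore costs a bounded factor,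
    while d(r q^N,.) tends to 0: so d(r,.) = 0 ([qdilation_rigidity]). The case
    n = 0 contains the normalization of the density.

    The continuity estimate is uniform in x and in n up to the factor n + 1. It
    combines two facts: an infinite product whose factors are within K t^k
    of 1 is itself within O(K) of 1, and Rogers' expansion of w_n in cosines has
    n + 1 terms with bounded coefficients ([nrogers_trig]). *)

Set Implicit Arguments.
Unset Strict Implicit.
Unset Printing Implicit Defensive.

(** * Infinite products with geometrically close factors *)

(** Expanding the product over u = 1 + v, every term of the difference is
    bounded by the same term for |v|, and 1 + |v| <= exp |v|. *)
Lemma prod_sub1_le (R : realType) (u : nat -> R) (n : nat) :
  `|\prod_(k < n) u k - 1| <= expR (\sum_(k < n) `|u k - 1|) - 1.
Proof.
elim: n => [|n IHn]; first by rewrite !big_ord0 subrr normr0 expR0 subrr.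
rewrite !big_ord_recr/=.
set P := \prod_(k < n) u k in IHn *; set S := \sum_(k < n) `|u k - 1| in IHn *.
have -> : P * u n - 1 = (P - 1) * (1 + (u n - 1)) + (u n - 1) by ring.
apply: (le_trans (ler_normD _ _)); rewrite normrM.
have h1 : `|1 + (u n - 1)| <= 1 + `|u n - 1|.
  by apply: (le_trans (ler_normD _ _)); rewrite normr1.
have h2 : `|P - 1| * `|1 + (u n - 1)| <= (expR S - 1) * (1 + `|u n - 1|).
  exact: ler_pM.
have h3 : expR S * (1 + `|u n - 1|) <= expR (S + `|u n - 1|).
  by rewrite expRD ler_pM2l ?expR_gt0// expR_ge1Dx.
nra.
Qed.

Lemma expR_sub1_le (R : realType) (x : R) : expR x - 1 <= x * expR x.
Proof.
have := expR_ge1Dx (- x); rewrite expRN => h.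
have e0 := expR_gt0 x.
have : (1 - x) * expR x <= (expR x)^-1 * expR x by rewrite ler_pM2r.
by rewrite mulVf ?gt_eqF//; lra.
Qed.

Section GeometricFactors.
Context (R : realType).
Implicit Types (t K : R) (u : nat -> R).

Definition geom_close t K u := forall k, `|u k - 1| <= K * t ^+ k.

(** A Lipschitz constant on [0, K] of the function exp (k / (1 - t)) of k. *)
Definition prod_const t K : R := (1 - t)^-1 * expR (K / (1 - t)).

Lemma sum_geometric_le t n : 0 <= t < 1 -> \sum_(k < n) t ^+ k <= (1 - t)^-1.
Proof.
move=> /andP[t0 t1].
rewrite -[leRHS]mul1r ler_pdivlMr ?subr_gt0//.
have -> : (\sum_(k < n) t ^+ k) * (1 - t) = 1 - t ^+ n.
  by rewrite mulrC -[1 - t]opprB mulNr -subrX1 opprB.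
by rewrite gerBl exprn_ge0.
Qed.

Lemma prod_const_ge0 t K : t < 1 -> 0 <= prod_const t K.
Proof. by move=> t1; rewrite mulr_ge0 ?expR_ge0// invr_ge0 subr_ge0 ltW. Qed.

(** The constant depends on the upper bound K0 only, so that the estimate is
    linear in K; this is what makes the density Lipschitz in its parameter. *)
Lemma geom_close_prod t K K0 u n : 0 <= t < 1 -> 0 <= K <= K0 ->
  geom_close t K u -> `|\prod_(k < n) u k - 1| <= prod_const t K0 * K.
Proof.
move=> t01 /andP[K_ge0 KK0] uK.
have t1 : 0 < (1 - t)^-1 by rewrite invr_gt0 subr_gt0; case/andP: t01.
apply: (le_trans (prod_sub1_le _ _)).
have hS : \sum_(k < n) `|u k - 1| <= K / (1 - t).
  apply: (@le_trans _ _ (\sum_(k < n) K * t ^+ k)).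
    by apply: ler_sum => i _; exact: uK.
  by rewrite -mulr_sumr ler_wpM2l// sum_geometric_le.
apply: (@le_trans _ _ (expR (K / (1 - t)) - 1)).
  by rewrite lerD2r ler_expR.
apply: (le_trans (expR_sub1_le (K / (1 - t)))).
have -> : prod_const t K0 * K = K / (1 - t) * expR (K0 / (1 - t)).
  by rewrite /prod_const; ring.
by rewrite ler_wpM2l ?divr_ge0 ?ler_expR ?ler_wpM2r// ltW// -invr_gt0.
Qed.

(** The partial products are bounded, so their increments are dominated by a
    geometric series. *)
Lemma geom_close_cvg t K u : 0 <= t < 1 -> geom_close t K u ->
  cvgn (fun n => \prod_(k < n) u k).
Proof.
move=> t01 uK.
have K0 : 0 <= K by have := uK 0%N; rewrite expr0 mulr1; apply: le_trans.
pose P n := \prod_(k < n) u k.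
pose d := telescope P.
have PE : P = (fun n => P 0%N + series d n).
  by apply/funext => n; exact: eq_sum_telescope.
rewrite -/P PE; apply: is_cvgD; first exact: is_cvg_cst.
apply: normed_cvg.
pose B := 1 + prod_const t K * K.
have PB n : `|P n| <= B.
  have -> : P n = 1 + (P n - 1) by ring.
  apply: (le_trans (ler_normD _ _)); rewrite normr1 lerD2l.
  by apply: geom_close_prod => //; rewrite K0 lexx.
apply: (@series_le_cvg _ _ (geometric (B * K) t)) => [n|n|n|] //=.
- rewrite mulr_ge0 ?exprn_ge0 ?mulr_ge0//; last by case/andP: t01.
  exact: le_trans (PB 0).
- rewrite /d /telescope /= {1}/P big_ord_recr/= -/(P n).
  have -> : P n * u n - P n = P n * (u n - 1) by ring.
  by rewrite normrM -mulrA ler_pM.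
- apply: is_cvg_geometric_series; case/andP: t01 => t0 t1.
  by rewrite ger0_norm.
Qed.

Lemma geom_close_infprod t K K0 u : 0 <= t < 1 -> 0 <= K <= K0 ->
  geom_close t K u -> `|infprod u - 1| <= prod_const t K0 * K.
Proof.
move=> t01 hK uK; have cu := geom_close_cvg t01 uK.
have : (fun n => `|\prod_(k < n) u k - 1|) @ \oo --> `|infprod u - 1|.
  by apply: cvg_norm; apply: cvgB; [exact: cu|exact: cvg_cst].
move=> /cvg_lim <- //; apply: limr_le.
  by apply: is_cvg_norm; apply: is_cvgB; [exact: cu|exact: is_cvg_cst].
by near=> n; exact: geom_close_prod.
Unshelve. all: by end_near. Qed.

Lemma infprod_recl t K u : 0 <= t < 1 -> geom_close t K u ->
  infprod u = u 0%N * infprod (fun k => u k.+1).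
Proof.
move=> /[dup] t01 /andP[t0 t1] uK.
have uK' : geom_close t K (fun k => u k.+1).
  move=> k; apply: (le_trans (uK k.+1)).
  rewrite exprS mulrCA ler_piMl ?(ltW t1)//; exact: le_trans (uK k).
have cu := geom_close_cvg t01 uK'.
rewrite /infprod; apply/cvg_lim => //.
rewrite -(cvg_shiftn 1)/=.
under eq_fun do rewrite addn1 big_ord_recl/=.
by apply: cvgM; [exact: cvg_cst|exact: cu].
Qed.

(** The products of the factors and of their inverses both converge; hence
    neither limit vanishes. *)
Lemma infprod_mulVl t K K' u : 0 <= t < 1 -> geom_close t K u ->
  geom_close t K' (fun k => (u k)^-1) -> (forall k, u k != 0) ->
  infprod (fun k => (u k)^-1) * infprod u = 1.
Proof.
move=> t01 uK uK' u0.
have c1 := geom_close_cvg t01 uK; have c2 := geom_close_cvg t01 uK'.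
have : (fun n => \prod_(k < n) (u k)^-1 * \prod_(k < n) u k) @ \oo
    --> infprod (fun k => (u k)^-1) * infprod u by exact: cvgM.
rewrite (_ : (fun n => _) = cst 1); last first.
  apply/funext => n /=; rewrite -big_split/= big1// => i _.
  by rewrite mulVf.
by move=> /(cvg_lim (@norm_hausdorff _ _)) <-; rewrite lim_cst.
Qed.

Lemma infprod_neq0 t K K' u : 0 <= t < 1 -> geom_close t K u ->
  geom_close t K' (fun k => (u k)^-1) -> (forall k, u k != 0) -> infprod u != 0.
Proof.
move=> t01 uK uK' u0; apply/eqP => e; have := infprod_mulVl t01 uK uK' u0.
by rewrite e mulr0 => /eqP; rewrite eq_sym oner_eq0.
Qed.

Lemma infprodV t K K' u : 0 <= t < 1 -> geom_close t K u ->
  geom_close t K' (fun k => (u k)^-1) -> (forall k, u k != 0) ->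
  infprod (fun k => (u k)^-1) = (infprod u)^-1.
Proof.
move=> t01 uK uK' u0; have i0 := infprod_neq0 t01 uK uK' u0.
by rewrite -[LHS]mulr1 -(divff i0) mulrA (infprod_mulVl t01 uK uK' u0) mul1r.
Qed.

End GeometricFactors.

(** * Rigidity of the relation between the parameters s and s q *)

Section Rigidity.
Context (R : realType).
Implicit Types (a b e t x C lam : R) (n : nat).

Lemma near1M a b e C1 C2 : 0 <= e <= 1 -> 0 <= C1 -> 0 <= C2 ->
  `|a - 1| <= C1 * e -> `|b - 1| <= C2 * e ->
  `|a * b - 1| <= (C1 + C2 + C1 * C2) * e.
Proof.
move=> /andP[e0 e1] C10 C20 ha hb.
have -> : a * b - 1 = (a - 1) + (b - 1) + (a - 1) * (b - 1) by ring.
have h : `|(a - 1) * (b - 1)| <= C1 * C2 * e.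
  rewrite normrM; apply: (@le_trans _ _ ((C1 * e) * (C2 * e))).
    by rewrite ler_pM.
  have -> : C1 * e * (C2 * e) = C1 * C2 * e * e by ring.
  by rewrite ler_piMr// !mulr_ge0.
have := ler_normD (a - 1 + (b - 1)) ((a - 1) * (b - 1)).
have := ler_normD (a - 1) (b - 1).
lra.
Qed.

Lemma near1V a e c : 0 < c -> c <= a -> `|a - 1| <= e -> `|a^-1 - 1| <= e / c.
Proof.
move=> c0 ca ha.
have a0 : 0 < a by exact: lt_le_trans ca.
have -> : a^-1 - 1 = (1 - a) / a by field; rewrite gt_eqF.
rewrite normrM normfV (gtr0_norm a0) distrC.
by rewrite ler_pM ?invr_ge0 ?(ltW a0)// lef_pV2.
Qed.

Lemma geometric_squeeze a t C : 0 <= t < 1 ->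
  (forall n, `|a| <= C * t ^+ n) -> a = 0.
Proof.
move=> /andP[t0 t1] h; apply/eqP; rewrite -normr_eq0; apply/eqP/le_anti.
rewrite normr_ge0 andbT.
have c : (fun n => C * t ^+ n) @ \oo --> 0.
  by have := @cvg_geometric R C t; rewrite ger0_norm// => /(_ t1).
have <- := cvg_lim (@norm_hausdorff _ _) c.
by apply: limr_ge; [apply: cvgP c|near=> n; exact: h].
Unshelve. all: by end_near. Qed.

Lemma natM_geometric_le lam n : 0 <= lam < 1 ->
  n.+1%:R * lam ^+ n <= (1 - lam)^-1.
Proof.
move=> /[dup] /andP[l0 l1] h; apply: le_trans (sum_geometric_le n.+1 h).
rewrite mulr_natl -[X in _ *+ X]card_ord -sumr_const; apply: ler_sum => i _.
by rewrite ler_wiXn2l// ?(ltW l1)// -ltnS.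
Qed.

(** Solving u_n = s u_{n+2} + O(v_n) for a sequence u of moderate growth: in
    the norm sup |u_n| lam^n the shift by 2 costs lam^-2, so the relation is a
    contraction as soon as |s| < lam^2. The a priori bound D makes the
    supremum finite. *)
Lemma contraction_le (u v : nat -> R) lam s k B D : 0 < lam -> 0 <= k ->
  `|s| / lam ^+ 2 < 1 ->
  (forall n, `|u n| * lam ^+ n <= D) ->
  (forall n, `|v n| * lam ^+ n <= B) ->
  (forall n, `|u n - s * u n.+2| <= k * `|v n|) ->
  forall n, `|u n| * lam ^+ n <= k / (1 - `|s| / lam ^+ 2) * B.
Proof.
move=> l0 k0 sl uD vB uv.
pose S := [set `|u n| * lam ^+ n | n in [set: nat]].
have S0 : S !=set0 by exists (`|u 0%N| * lam ^+ 0); exists 0%N.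
have SD : has_ubound S by exists D => _ [n _ <-].
have uS n : `|u n| * lam ^+ n <= sup S by apply: ub_le_sup => //; exists n.
have step : sup S <= `|s| / lam ^+ 2 * sup S + k * B.
  apply: ge_sup => // _ [n _ <-].
  have -> : u n = s * u n.+2 + (u n - s * u n.+2) by ring.
  have h1 := ler_normD (s * u n.+2) (u n - s * u n.+2).
  have ln : 0 <= lam ^+ n by rewrite exprn_ge0// ltW.
  apply: (@le_trans _ _ ((`|s * u n.+2| + k * `|v n|) * lam ^+ n)).
    by rewrite ler_wpM2r// (le_trans h1)// lerD2l.
  rewrite mulrDl lerD//; last by rewrite -mulrA ler_wpM2l.
  rewrite normrM.
  have -> : `|s| * `|u n.+2| * lam ^+ n =
      `|s| / lam ^+ 2 * (`|u n.+2| * lam ^+ n.+2).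
    by rewrite -addn2 exprD; field; rewrite gt_eqF.
  by rewrite ler_wpM2l// divr_ge0// exprn_ge0// ltW.
move=> n; apply: (le_trans (uS n)).
have h : 0 < 1 - `|s| / lam ^+ 2 by lra.
rewrite mulrAC ler_pdivlMr//; lra.
Qed.

(** Zeros propagate from q to the powers of q, then to 0 by
    continuity. From there the Lipschitz bound makes d (s q^N) as small as
    |q|^N, and [contraction_le] brings this bound back up to s. The accumulated
    factor is a partial product of K (s q^i) = 1 + O(|q|^i), hence bounded. *)
Lemma qdilation_rigidity (q : R) (d : R -> nat -> R) : `|q| < 1 ->
  (forall (s : R) n, `|s| < 1 -> d s n - s * d s n.+2 =
     (1 - s * q ^+ n.+1) / (1 - s * q) * d (s * q) n) ->
  (forall rho : R, 0 <= rho < 1 -> exists2 C : R, 0 <= C &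
     forall (s : R) n, `|s| <= rho -> `|d s n - d 0 n| <= C * n.+1%:R * `|s|) ->
  (forall n, d q n = 0) ->
  forall (s : R) n, `|s| < 1 -> d s n = 0.
Proof.
move=> hq H1 H2 H3 r n0 hr.
have sq_lt (s : R) k : `|s| < 1 -> `|s * q ^+ k| < 1.
  move=> hs; rewrite normrM normrX; apply: le_lt_trans hs.
  by rewrite ler_piMr// exprn_ile1// ltW.
have fac0 (s : R) k : `|s| < 1 -> 1 - s * q ^+ k != 0.
  move=> hs; rewrite subr_eq0; apply/eqP => e; have := sq_lt s k hs.
  by rewrite -e normr1 ltxx.
have dq N n : d (q ^+ N.+1) n = 0.
  elim: N n => [|N IHN] n; first by rewrite expr1.
  have hN : `|q ^+ N.+1| < 1.
    by rewrite exprS; exact: (sq_lt q N hq).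
  have := H1 _ n hN; rewrite !IHN mulr0 subrr -exprSr => /esym/eqP.
  have f2 := fac0 _ 1%N hN; rewrite expr1 -exprSr in f2.
  rewrite mulf_eq0 => /orP[|/eqP//].
  by rewrite mulf_eq0 invr_eq0 (negbTE (fac0 _ _ hN)) (negbTE f2).
have d0 n : d 0 n = 0.
  have [|C C0 hC] := H2 `|q|; first by rewrite normr_ge0.
  apply: (@geometric_squeeze _ `|q| (C * n.+1%:R)) => [|N].
    by rewrite normr_ge0.
  have := hC (q ^+ N.+1) n; rewrite dq sub0r normrN normrX exprS.
  move=> /(_ _)/le_trans-> //.
    by rewrite ler_piMr// exprn_ile1// ltW.
  rewrite ler_wpM2l ?mulr_ge0//; rewrite ler_piMl ?exprn_ge0// ltW//.
set rho := `|r|.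
have rho0 : 0 <= rho by rewrite normr_ge0.
have [|C C0 hC] := H2 rho; first by rewrite rho0.
(* rho < lam ^ 2 < 1, by the inequality between the two means of 1 and rho *)
pose lam : R := (1 + rho) / 2.
have l0 : 0 < lam by rewrite /lam; lra.
have l1 : lam < 1 by rewrite /lam /rho; lra.
have l2 : 0 < lam ^+ 2 by rewrite exprn_gt0.
have rl : rho < lam ^+ 2.
  rewrite /lam; have : 0 < (1 - rho) ^+ 2 by rewrite exprn_gt0 ?subr_gt0.
  nra.
clearbody lam.
pose mu : R := rho / lam ^+ 2.
have mu1 : mu < 1 by rewrite /mu ltr_pdivrMr ?mul1r.
have mu0 : 0 <= mu by rewrite /mu divr_ge0 ?(ltW l2).
pose D : R := C / (1 - lam).
have D0 : 0 <= D by rewrite /D divr_ge0 ?subr_ge0 ?(ltW l1).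
have hD (s : R) n : `|s| <= rho -> `|d s n| * lam ^+ n <= D * `|s|.
  move=> hs; have := hC s n hs; rewrite d0 subr0 => h.
  apply: (@le_trans _ _ (C * n.+1%:R * `|s| * lam ^+ n)).
    by rewrite ler_wpM2r// exprn_ge0// ltW.
  have -> : C * n.+1%:R * `|s| * lam ^+ n = C * (n.+1%:R * lam ^+ n) * `|s|.
    by ring.
  by rewrite ler_wpM2r// ler_wpM2l// natM_geometric_le// l1 ltW.
pose K (s : R) : R := (1 + `|s|) / (1 - `|s|) / (1 - `|s| / lam ^+ 2).
have slt (s : R) : `|s| <= rho -> `|s| / lam ^+ 2 <= mu.
  by move=> hs; rewrite /mu ler_wpM2r// invr_ge0 ltW.
have K0 (s : R) : `|s| <= rho -> 0 <= K s.
  move=> hs; have := slt s hs => hs'.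
  rewrite /K !divr_ge0 ?subr_ge0 ?addr_ge0//; first by rewrite (le_trans hs)// ltW.
  by lra.
have step (s B : R) : `|s| <= rho -> (forall n, `|d (s * q) n| * lam ^+ n <= B) ->
    forall n, `|d s n| * lam ^+ n <= K s * B.
  move=> hs hB n.
  have s1 : `|s| < 1 by exact: le_lt_trans hr.
  apply: (contraction_le l0 _ _ (hD s ^~ hs) hB).
  - by rewrite divr_ge0 ?subr_ge0 ?addr_ge0// ltW.
  - by apply: le_lt_trans mu1; exact: slt.
  - move=> {}n; rewrite H1// normrM ler_wpM2r// normrM normfV ler_pM//.
    + rewrite (le_trans (ler_normB _ _))// normr1 lerD2l normrM normrX.
      by rewrite ler_piMr// exprn_ile1// ltW.
    + rewrite lef_pV2 ?posrE ?subr_gt0// ?normr_gt0; last first.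
        by have := fac0 s 1%N s1; rewrite expr1.
      have := lerB_dist 1 (s * q); rewrite normr1 normrM.
      have : `|s| * `|q| <= `|s| by rewrite ler_piMr// ltW.
      lra.
have climb N : forall (s : R) n, `|s| <= rho ->
    `|d s n| * lam ^+ n <= (\prod_(i < N) K (s * q ^+ i)) * (D * (`|s| * `|q| ^+ N)).
  elim: N => [|N IHN] s n hs; first by rewrite big_ord0 mul1r expr0 mulr1 hD.
  have hsq : `|s * q| <= rho.
    by rewrite normrM (le_trans _ hs)// ler_piMr// ltW.
  have := step s _ hs (fun n => IHN (s * q) n hsq) n.
  rewrite big_ord_recl/= expr0 mulr1 normrM exprS => /le_trans; apply.
  rewrite !mulrA; under eq_bigr do rewrite -mulrA -exprS.
  by under [in leRHS]eq_bigr do rewrite /bump/= add1n; rewrite -!mulrA.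
have [M M0 KM] : exists2 M, 0 <= M & forall s : R, `|s| <= rho -> `|K s - 1| <= M * `|s|.
  pose C1 : R := 2 / (1 - rho); pose C2 : R := (lam ^+ 2 * (1 - mu))^-1.
  have C10 : 0 <= C1 by rewrite /C1 divr_ge0 ?subr_ge0 ?(ltW hr).
  have C20 : 0 <= C2.
    by rewrite /C2 invr_ge0 mulr_ge0 ?subr_ge0 ?(ltW mu1) ?(ltW l2).
  exists (C1 + C2 + C1 * C2); first exact: addr_ge0 (addr_ge0 C10 C20) (mulr_ge0 C10 C20).
  move=> s hs; have s1 : `|s| < 1 by exact: le_lt_trans hr.
  have hmu := slt s hs.
  apply: near1M => //; first by rewrite normr_ge0 ltW.
  - have -> : (1 + `|s|) / (1 - `|s|) - 1 = 2 / (1 - `|s|) * `|s|.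
      by field; rewrite gt_eqF// subr_gt0.
    rewrite ger0_norm ?mulr_ge0 ?invr_ge0 ?subr_ge0 ?(ltW s1)//.
    rewrite ler_wpM2r// /C1 ler_wpM2l// lef_pV2 ?posrE ?subr_gt0//.
    by rewrite lerD2l lerN2.
  - have p1 : 0 < 1 - `|s| / lam ^+ 2 by lra.
    have -> : (1 - `|s| / lam ^+ 2)^-1 - 1
        = (lam ^+ 2 * (1 - `|s| / lam ^+ 2))^-1 * `|s|.
      have p2 : lam ^+ 2 - `|s| != 0.
        by rewrite subr_eq0 gt_eqF// (le_lt_trans hs).
      by field; rewrite p2 gt_eqF.
    rewrite ger0_norm; last by rewrite mulr_ge0// invr_ge0 mulr_ge0// ltW.
    rewrite ler_wpM2r// /C2 lef_pV2 ?posrE ?mulr_gt0 ?subr_gt0 ?(le_lt_trans hmu)//.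
    by rewrite ler_pM2l// lerD2l lerN2.
have q01 : 0 <= `|q| < 1 by rewrite normr_ge0.
have Kgeom : geom_close `|q| (M * rho) (fun i => K (r * q ^+ i)).
  move=> i; have := KM (r * q ^+ i); rewrite normrM normrX => /(_ _)/le_trans->//.
    by rewrite ler_piMr// exprn_ile1// ltW.
  by rewrite mulrA.
pose P : R := 1 + prod_const `|q| (M * rho) * (M * rho).
have dlam : d r n0 * lam ^+ n0 = 0.
  apply: (@geometric_squeeze _ `|q| (P * D * rho)) => // N.
  rewrite normrM normrX (gtr0_norm l0); apply: (le_trans (climb N r n0 _)) => //.
  have -> : P * D * rho * `|q| ^+ N = P * (D * (`|r| * `|q| ^+ N)).
    by rewrite -!mulrA.
  rewrite ler_wpM2r//.
    by rewrite (mulr_ge0 D0)// mulr_ge0 ?exprn_ge0.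
  have Mr : 0 <= M * rho <= M * rho by rewrite lexx mulr_ge0.
  have := geom_close_prod N q01 Mr Kgeom.
  rewrite ler_norml lerBlDl => /andP[_ h]. exact: h.
by move/eqP: dlam; rewrite mulf_eq0 expf_eq0 (gt_eqF l0) andbF orbF => /eqP.
Qed.

End Rigidity.

(** * Recurrences of the Rogers polynomials *)

Section Algebra.
Context (R : realType).
Implicit Types (q s r a x y th : R) (n k : nat).

Lemma qpoch0 a q : qpoch a q 0 = 1.
Proof. exact: big_ord0. Qed.

Lemma qpochS a q n : qpoch a q n.+1 = qpoch a q n * (1 - a * q ^+ n).
Proof. exact: big_ord_recr. Qed.

Lemma norm_mulXn_le a q n : `|q| < 1 -> `|a * q ^+ n| <= `|a|.
Proof. by move=> hq; rewrite normrM normrX ler_piMr// exprn_ile1// ltW. Qed.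

Lemma sub1_mulXn_neq0 a q n : `|q| < 1 -> `|a| < 1 -> 1 - a * q ^+ n != 0.
Proof.
move=> hq ha; rewrite subr_eq0; apply/eqP => e.
by have := norm_mulXn_le a n hq; rewrite -e normr1 leNgt ha.
Qed.

Lemma sub1_Xn_neq0 q n : `|q| < 1 -> 1 - q ^+ n.+1 != 0.
Proof. by move=> hq; rewrite exprS; exact: sub1_mulXn_neq0. Qed.

Lemma qpoch_neq0 a q n : `|q| < 1 -> `|a| < 1 -> qpoch a q n != 0.
Proof. by move=> hq ha; apply/prodf_neq0 => i _; exact: sub1_mulXn_neq0. Qed.

Lemma sqr_norm_lt1 a : `|a| < 1 -> `|a ^+ 2| < 1.
Proof. by move=> ha; rewrite normrX expr_lt1. Qed.

Lemma qintE q n : `|q| < 1 -> qint q n = (1 - q ^+ n) / (1 - q).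
Proof.
move=> hq; have q1 : 1 - q != 0 by have := sub1_Xn_neq0 0 hq; rewrite expr1.
apply: (mulIf q1); rewrite divfK// /qint mulrC -[1 - q]opprB mulNr -subrX1.
by rewrite opprB.
Qed.

Lemma rec2_unique (A B C u v : nat -> R) : (forall n, A n != 0) ->
  (forall n, A n * u n.+2 = B n * u n.+1 - C n * u n) ->
  (forall n, A n * v n.+2 = B n * v n.+1 - C n * v n) ->
  u 0%N = v 0%N -> u 1%N = v 1%N -> u =1 v.
Proof.
move=> A0 hu hv e0 e1 n; suff [] : u n = v n /\ u n.+1 = v n.+1 by [].
elim: n => [//|n [IH0 IH1]]; split=> //.
by apply: (mulfI (A0 n)); rewrite hu hv IH0 IH1.
Qed.

Definition rogers_coef r q n : R :=
  qint q n.+1 * ((1 - r ^+ 2 * q ^+ n)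
                 / ((1 - r * q ^+ n) * (1 - r * q ^+ n.+1))).

Lemma rogersSS r q n : rogers r q n.+2 =
  'X * rogers r q n.+1 - rogers_coef r q n *: rogers r q n.
Proof. by []. Qed.

Lemma horner_rogersSS r q n x : (rogers r q n.+2).[x] =
  x * (rogers r q n.+1).[x] - rogers_coef r q n * (rogers r q n).[x].
Proof. by rewrite rogersSS hornerD hornerN hornerM hornerX hornerZ. Qed.

Lemma rogers0 r q : rogers r q 0 = 1.
Proof. by []. Qed.

Lemma rogers1 r q : rogers r q 1 = 'X.
Proof. by rewrite /= mulr1 subr0. Qed.

Lemma horner_ASCSS y r q n x : (ASC y r q n.+2).[x] =
  (x - r * y * q ^+ n.+1) * (ASC y r q n.+1).[x]
  - (1 - r ^+ 2 * q ^+ n) * qint q n.+1 * (ASC y r q n).[x].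
Proof.
rewrite [ASC y r q n.+2]/(_ * ASC y r q n.+1 - _ *: ASC y r q n).
by rewrite hornerD hornerN hornerM hornerXsubC hornerZ.
Qed.

Lemma rogers_ASC r q n x : `|q| < 1 -> `|r| < 1 ->
  (rogers r q n).[x] = (ASC x r q n).[x] / qpoch r q n.
Proof.
move=> hq hr; move: n; have f n := sub1_mulXn_neq0 n hq hr.
have f0 : 1 - r != 0 by have := f 0%N; rewrite expr0 mulr1.
apply: (@rec2_unique (cst 1) (cst x) (fun n => rogers_coef r q n)) => [n|n|n||].
- by rewrite oner_eq0.
- by rewrite horner_rogersSS /cst mul1r.
- rewrite horner_ASCSS /rogers_coef !qpochS.
  have := qpoch_neq0 n hq hr => p; have := f n; have := f n.+1 => f1 fn.
  by rewrite /cst/=; field; rewrite p f1 fn.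
- by rewrite /= hornerE qpoch0 divr1.
- by rewrite /= !hornerE qpochS qpoch0 !expr0 !mulr1; field.
Qed.

(** For s <> 0, the multiple of w_n that takes the value s^(-n/2) at a zero of
    l_q(x|s). With this scaling the coefficients 1 and - s in
    [nrogers_contiguous] do not depend on n. *)
Definition nrogers s q n x : R :=
  Num.sqrt (1 - q) ^+ n * (qpoch s q n / qpoch (s ^+ 2) q n)
  * (rogers s q n).[x].

Section Recurrence.
Variables (q s : R).
Hypotheses (hq : `|q| < 1) (hs : `|s| < 1).

Let f n := sub1_mulXn_neq0 n hq hs.
Let g n := sub1_mulXn_neq0 n hq (sqr_norm_lt1 hs).

Lemma onem_neq0 : 1 - s != 0.
Proof. by have := f 0%N; rewrite expr0 mulr1. Qed.

Lemma onep_neq0 : 1 + s != 0.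
Proof.
apply: contraTneq hs; rewrite addrC => /eqP; rewrite addr_eq0 => /eqP ->.
by rewrite normrN normr1 ltxx.
Qed.

Lemma nrogers0 x : nrogers s q 0 x = 1.
Proof. by rewrite /nrogers !qpoch0 /= divr1 !hornerE. Qed.

Lemma nrogers1 x : nrogers s q 1 x = Num.sqrt (1 - q) * x / (1 + s).
Proof.
rewrite /nrogers !qpochS !qpoch0 expr1 !expr0 !mulr1 !mul1r rogers1 hornerX.
have -> : 1 - s ^+ 2 = (1 - s) * (1 + s) by ring.
by field; rewrite onem_neq0 onep_neq0.
Qed.

Lemma nrogersSS n x : (1 - s ^+ 2 * q ^+ n.+1) * nrogers s q n.+2 x =
  Num.sqrt (1 - q) * x * (1 - s * q ^+ n.+1) * nrogers s q n.+1 x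
  - (1 - q ^+ n.+1) * nrogers s q n x.
Proof.
have q1 : 0 < 1 - q by rewrite subr_gt0; apply: le_lt_trans hq; rewrite ler_norm.
have tt : Num.sqrt (1 - q) ^+ 2 = 1 - q by rewrite sqr_sqrtr ?ltW.
rewrite /nrogers horner_rogersSS /rogers_coef qintE// !qpochS.
have t0 : Num.sqrt (1 - q) != 0 by rewrite sqrtr_eq0 -ltNge.
set t := Num.sqrt (1 - q) in tt t0 *; rewrite -tt (exprS t n.+1) (exprS t n).
have := qpoch_neq0 n hq hs => p1; have := qpoch_neq0 n hq (sqr_norm_lt1 hs) => p2.
have := f n; have := f n.+1; have := g n; have := g n.+1.
move=> g1 g0 f1 f0; rewrite (exprS q n) in g1 f1 *.
by field; rewrite ?p2 ?p1 ?g1 ?g0 ?f1 ?f0 ?t0.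
Qed.

End Recurrence.

Definition trig_weight q s k : R := qpoch s q k / qpoch q q k.

(** The continuous q-ultraspherical polynomial C_n(cos th; s|q) of Rogers. *)
Definition trig_sum q s th n : R := \sum_(k < n.+1)
  trig_weight q s k * trig_weight q s (n - k) * cos ((n%:R - k%:R *+ 2) * th).

Lemma mul2cos_cos a th :
  2 * cos th * cos (a * th) = cos ((a + 1) * th) + cos ((a - 1) * th).
Proof.
rewrite [(a + 1) * th]mulrDl [(a - 1) * th]mulrDl mulN1r mul1r.
by rewrite !cosD cosN sinN; ring.
Qed.

Lemma trig_weightS q s k : `|q| < 1 ->
  trig_weight q s k.+1 = (1 - s * q ^+ k) / (1 - q ^+ k.+1) * trig_weight q s k.
Proof.
move=> hq; have p := qpoch_neq0 k hq hq; have h := sub1_Xn_neq0 k hq.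
by rewrite /trig_weight !qpochS exprS in h *; field; rewrite p h.
Qed.

(** Compare the coefficients of cos ((n - 2 i) th): multiplying by 2 cos th
    shifts the frequency by 1 both ways, and the remaining identity between
    products of weights is rational in q^i and q^(n-i). The two extreme
    frequencies are treated apart. *)
Lemma trig_sumSS q s th n : `|q| < 1 ->
  (1 - q ^+ n.+2) * trig_sum q s th n.+2 =
  2 * cos th * (1 - s * q ^+ n.+1) * trig_sum q s th n.+1
  - (1 - s ^+ 2 * q ^+ n) * trig_sum q s th n.
Proof.
move=> hq; set w := trig_weight q s.
have wS k : w k.+1 = (1 - s * q ^+ k) / (1 - q ^+ k.+1) * w k by exact: trig_weightS.
have nz k : 1 - q ^+ k.+1 != 0 by exact: sub1_Xn_neq0.
pose c (k : nat) := cos ((n%:R - k%:R *+ 2) * th).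
have LE : trig_sum q s th n.+2 = w 0%N * w n.+2 * cos (n.+2%:R * th)
    + \sum_(i < n.+1) w i.+1 * w (n - i).+1 * c i
    + w n.+2 * w 0%N * cos (n.+2%:R * th).
  rewrite /trig_sum big_ord_recl big_ord_recr/= addrA; congr (_ + _ + _).
  - by rewrite subn0 mul0rn subr0.
  - apply: eq_bigr => i _; rewrite /bump/= add1n.
    rewrite -subSn; last by rewrite -ltnS.
    rewrite /c; congr (_ * cos (_ * _)).
    by rewrite -!natr1; ring.
  - rewrite subnn; congr (_ * _); rewrite -cosN; congr cos.
    have -> : bump 0 n.+1 = n.+2 by [].
    by rewrite -!natr1; ring.
have M1 : 2 * cos th * trig_sum q s th n.+1 = w 0%N * w n.+1 * cos (n.+2%:R * th)
    + \sum_(i < n.+1) (w i.+1 * w (n - i)%N + w i * w (n - i).+1) * c i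
    + w n.+1 * w 0%N * cos (n.+2%:R * th).
  rewrite /trig_sum mulr_sumr.
  under eq_bigr => i _ do rewrite mulrCA mul2cos_cos mulrDr.
  rewrite big_split/= big_ord_recl [X in _ + X]big_ord_recr/= !addrA.
  congr (_ + _).
    under [in RHS]eq_bigr do rewrite mulrDl.
    rewrite big_split/= addrA; congr (_ + _ + _).
    - by rewrite subn0 mul0rn subr0 natr1.
    - apply: eq_bigr => i _; rewrite /bump/= add1n subSS /c.
      congr (_ * cos (_ * _)).
      by rewrite -!natr1; ring.
    - apply: eq_bigr => i _; rewrite -subSn; last by rewrite -ltnS.
      by rewrite /c; congr (_ * cos (_ * _)); rewrite -!natr1; ring.
  rewrite subnn; congr (_ * _); rewrite -cosN; congr cos.
  by rewrite -!natr1; ring.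
have wSS : (1 - q ^+ n.+2) * w n.+2 = (1 - s * q ^+ n.+1) * w n.+1.
  by rewrite wS; field; exact: nz.
set X := \sum_(i < n.+1) _ in LE; set Y := \sum_(i < n.+1) _ in M1.
have XY : (1 - q ^+ n.+2) * X =
    (1 - s * q ^+ n.+1) * Y - (1 - s ^+ 2 * q ^+ n) * trig_sum q s th n.
  rewrite /X /Y /trig_sum !mulr_sumr -sumrB; apply: eq_bigr => i _.
  rewrite -/(c i) -/w !wS.
  have := nz i; have := nz (n - i)%N.
  have -> : q ^+ n = q ^+ i * q ^+ (n - i) by rewrite -exprD subnKC// -ltnS.
  rewrite -[n.+2]/(n.+1).+1 !exprS.
  have -> : q ^+ n = q ^+ i * q ^+ (n - i) by rewrite -exprD subnKC// -ltnS.
  by move=> h1 h2; field; rewrite h1 h2.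
rewrite LE [in RHS]mulrAC M1.
have -> : (1 - q ^+ n.+2) * (w 0%N * w n.+2 * cos (n.+2%:R * th) + X
    + w n.+2 * w 0%N * cos (n.+2%:R * th)) = (1 - q ^+ n.+2) * X
    + 2 * w 0%N * cos (n.+2%:R * th) * ((1 - q ^+ n.+2) * w n.+2) by ring.
by rewrite XY wSS; ring.
Qed.

Definition ntrig_sum q s th n : R :=
  qpoch q q n / qpoch (s ^+ 2) q n * trig_sum q s th n.

(** Both sides satisfy the same second order recurrence. *)
Lemma nrogers_trig q s th x n : `|q| < 1 -> `|s| < 1 ->
  Num.sqrt (1 - q) * x = 2 * cos th -> nrogers s q n x = ntrig_sum q s th n.
Proof.
move=> hq hs hx; move: n.
have g n := sub1_mulXn_neq0 n hq (sqr_norm_lt1 hs).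
have p n := qpoch_neq0 n hq (sqr_norm_lt1 hs).
have q1 : 1 - q != 0 by have := sub1_Xn_neq0 0 hq; rewrite expr1.
have w0 : trig_weight q s 0 = 1 by rewrite /trig_weight !qpoch0 divr1.
have w1 : trig_weight q s 1 = (1 - s) / (1 - q).
  by rewrite trig_weightS// w0 expr0 expr1 !mulr1.
have s1 := onem_neq0 hq hs; have s1' := onep_neq0 hs.
apply: (@rec2_unique (fun n => 1 - s ^+ 2 * q ^+ n.+1)
  (fun n => 2 * cos th * (1 - s * q ^+ n.+1)) (fun n => 1 - q ^+ n.+1)).
- by move=> n; exact: g.
- by move=> n; rewrite nrogersSS// hx.
- move=> n; rewrite /ntrig_sum.
  have e : qpoch q q n.+2 = qpoch q q n.+1 * (1 - q ^+ n.+2).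
    by rewrite qpochS -exprS.
  have -> : (1 - s ^+ 2 * q ^+ n.+1) * (qpoch q q n.+2 / qpoch (s ^+ 2) q n.+2
     * trig_sum q s th n.+2) = qpoch q q n.+1 / qpoch (s ^+ 2) q n.+1
     * ((1 - q ^+ n.+2) * trig_sum q s th n.+2).
    by rewrite e (qpochS (s ^+ 2)); field; rewrite p g.
  rewrite trig_sumSS// !qpochS -exprS.
  by field; rewrite p g.
- rewrite nrogers0 /ntrig_sum !qpoch0 divr1 mul1r /trig_sum big_ord1 subn0 w0 !mul1r.
  by rewrite mul0rn subr0 mul0r cos0.
- rewrite nrogers1// hx /ntrig_sum !qpochS !qpoch0 /trig_sum !big_ord_recr big_ord0/=.
  rewrite subn0 subnn w0 w1 mul0rn subr0 add0r mul1r.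
  have -> : (1 - 1 *+ 2) * th = - th by ring.
  rewrite cosN !expr0 !mulr1 !mul1r.
  have -> : 1 - s ^+ 2 = (1 - s) * (1 + s) by ring.
  by field; rewrite q1 s1 s1'.
Qed.

(** The difference on the right vanishes at the zeros of l_q(x|s), where E_n
    is s^(-n/2) up to sign, so it is divisible by l_q(x|s). The proof checks
    that the quotient satisfies the recurrence for the parameter s q. *)
Lemma nrogers_contiguous q s x n : `|q| < 1 -> `|s| < 1 ->
  (1 - s * q ^+ n.+1) / ((1 + s) * (1 - s ^+ 2 * q)) * lq q x s
    * nrogers (s * q) q n x
  = nrogers s q n x - s * nrogers s q n.+2 x.
Proof.
move=> hq hs.
have hsq : `|s * q| < 1 by rewrite normrM mulr_ilt1.
have f k := sub1_mulXn_neq0 k hq hs.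
have g k := sub1_mulXn_neq0 k hq (sqr_norm_lt1 hs).
have g' k := sub1_mulXn_neq0 k hq (sqr_norm_lt1 hsq).
have s1 := onem_neq0 hq hs; have s1' := onep_neq0 hs.
have s1q := onep_neq0 hsq.
have g1 := g 1%N; rewrite expr1 in g1.
have q1 : 0 < 1 - q by rewrite subr_gt0; apply: le_lt_trans hq; rewrite ler_norm.
pose y := Num.sqrt (1 - q) * x.
have ly : lq q x s = (1 + s) ^+ 2 - s * y ^+ 2.
  by rewrite /lq /y exprMn sqr_sqrtr ?ltW//; ring.
have ESS k := nrogersSS hq hs k x; rewrite -/y in ESS.
have E2 k : nrogers s q k.+2 x = (y * (1 - s * q ^+ k.+1) * nrogers s q k.+1 x
    - (1 - q ^+ k.+1) * nrogers s q k x) / (1 - s ^+ 2 * q ^+ k.+1).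
  by rewrite -ESS mulrC mulKf.
pose v k := (1 + s) * (1 - s ^+ 2 * q) / (1 - s * q ^+ k.+1)
   * (nrogers s q k x - s * nrogers s q k.+2 x).
suff h : lq q x s * nrogers (s * q) q n x = v n.
  by rewrite -mulrA h /v; field; rewrite f s1' g1.
move: n; apply: (@rec2_unique (fun n => 1 - s ^+ 2 * q ^+ n.+3)
  (fun n => y * (1 - s * q ^+ n.+2)) (fun n => 1 - q ^+ n.+1)).
- by move=> n; exact: g.
- move=> n; have := nrogersSS hq hsq n x; rewrite -/y.
  have -> : (s * q) ^+ 2 * q ^+ n.+1 = s ^+ 2 * q ^+ n.+3.
    by rewrite !exprS; ring.
  have -> : s * q * q ^+ n.+1 = s * q ^+ n.+2 by rewrite !exprS; ring.
  by move=> h; rewrite mulrCA h; ring.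
- move=> n; rewrite /v.
  have := f n.+1; have := f n.+2; have := f n.+3.
  rewrite (E2 n.+2) (E2 n.+1) (E2 n).
  have := g n.+1; have := g n.+2; have := g n.+3; rewrite !(exprS q) !expr2 => *.
  by field; do ![apply/andP; split].
- rewrite /v E2 !nrogers0 nrogers1// -/y ly !expr1.
  have f1 := f 1%N; rewrite expr1 in f1.
  by rewrite expr2 in g1 *; field; rewrite s1' g1 f1.
- rewrite /v (E2 1%N) (E2 0%N) !nrogers0 !nrogers1// -/y ly.
  have := f 2; have := f 1%N; have := g 2; have := g 1%N.
  rewrite !(exprS q) expr0 ?mulr1 !expr2 => *.
  by field; do ![apply/andP; split].
Qed.

End Algebra.

(** * Uniform estimates on the support *)

Section Estimates.
Context (R : realType) (q : R).
Hypothesis hq : `|q| < 1.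
Implicit Types (a s x rho C : R) (n k : nat).

Let q01 : 0 <= `|q| < 1. Proof. by rewrite normr_ge0. Qed.

Let q1 : 0 < 1 - q.
Proof. by rewrite subr_gt0; apply: le_lt_trans hq; rewrite ler_norm. Qed.

Lemma Sq_bounds x : Sq q x -> 0 <= (1 - q) * x ^+ 2 <= 4.
Proof.
rewrite /Sq /= in_itv/= => /andP[h1 h2].
rewrite mulr_ge0 ?sqr_ge0 ?(ltW q1)//=.
set t := Num.sqrt (1 - q) in h1 h2 *.
have t0 : 0 < t by rewrite sqrtr_gt0.
have -> : 1 - q = t ^+ 2 by rewrite sqr_sqrtr// ltW.
rewrite -exprMn; have {}h2 : t * x <= 2 by rewrite mulrC -ler_pdivlMr.
have {}h1 : - 2 <= t * x by rewrite mulrC -ler_pdivrMr// mulNr.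
nra.
Qed.

Lemma Sq_cos x : Sq q x -> exists th, Num.sqrt (1 - q) * x = 2 * cos th.
Proof.
move=> /Sq_bounds /andP[_ h].
set c := Num.sqrt (1 - q) * x.
have hc : c ^+ 2 <= 4 by rewrite exprMn sqr_sqrtr// ltW.
exists (acos (c / 2)); rewrite acosK.
  by field.
by rewrite in_itv/=; apply/andP; split; nra.
Qed.

Lemma lq_near1 x a : Sq q x -> `|a| <= 1 -> `|lq q x a - 1| <= 3 * `|a|.
Proof.
move=> /Sq_bounds /andP[h1 h2] ha.
have -> : lq q x a - 1 = (2 - (1 - q) * x ^+ 2 + a) * a by rewrite /lq; ring.
rewrite normrM ler_wpM2r//.
move: ha; rewrite !ler_norml => /andP[? ?]; apply/andP; split; lra.
Qed.

(** With (1 - q) x^2 = 4 cos^2 th, l_q(x|a) is |1 - a e^{2 i th}|^2. It is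
    affine in (1 - q) x^2, with the values (1 + a)^2 and (1 - a)^2 at 0 and 4. *)
Lemma lq_ge x a rho : Sq q x -> `|a| <= rho -> rho < 1 ->
  (1 - rho) ^+ 2 <= lq q x a.
Proof.
move=> /Sq_bounds /andP[h1 h2] ha r1; rewrite /lq.
set t := (1 - q) * x ^+ 2 in h1 h2.
have -> : (1 - q) * a * x ^+ 2 = a * t by rewrite /t; ring.
move: ha; rewrite ler_norml => /andP[? ?].
case: (lerP 0 a) => a0.
  apply: (@le_trans _ _ ((1 - a) ^+ 2)); last by nra.
  by rewrite ler_sqr ?nnegrE; lra.
apply: (@le_trans _ _ ((1 + a) ^+ 2)); last by nra.
by rewrite ler_sqr ?nnegrE; lra.
Qed.

Lemma geom_close_qpoch a : geom_close `|q| `|a| (fun k => 1 - a * q ^+ k).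
Proof.
move=> k; have -> : 1 - a * q ^+ k - 1 = - (a * q ^+ k) by ring.
by rewrite normrN normrM normrX.
Qed.

Lemma geom_close_qpochV a rho : `|a| <= rho -> rho < 1 ->
  geom_close `|q| (`|a| / (1 - rho)) (fun k => (1 - a * q ^+ k)^-1).
Proof.
move=> ha r1 k; rewrite mulrAC; apply: near1V; first by rewrite subr_gt0.
  have := norm_mulXn_le a k hq; have := ler_norm (a * q ^+ k); lra.
exact: geom_close_qpoch.
Qed.

Lemma geom_close_lq x a : Sq q x -> `|a| <= 1 ->
  geom_close `|q| (3 * `|a|) (fun k => lq q x (a * q ^+ k)).
Proof.
move=> hx ha k; apply: le_trans (lq_near1 hx _) _.
  by rewrite (le_trans (norm_mulXn_le _ _ hq)).
by rewrite normrM normrX mulrA.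
Qed.

Lemma geom_close_lqV x a rho : Sq q x -> `|a| <= rho -> rho < 1 ->
  geom_close `|q| (3 * `|a| / (1 - rho) ^+ 2) (fun k => (lq q x (a * q ^+ k))^-1).
Proof.
move=> hx ha r1 k; rewrite mulrAC; apply: near1V.
- by rewrite exprn_gt0 ?subr_gt0.
- by apply: lq_ge => //; rewrite (le_trans (norm_mulXn_le _ _ hq)).
- by apply: geom_close_lq => //; rewrite (le_trans ha)// ltW.
Qed.

Lemma qpoch_near rho : 0 <= rho < 1 -> exists2 C, 0 <= C &
  forall a, `|a| <= rho -> (forall n, `|qpoch a q n - 1| <= C * `|a| /\
     `|(qpoch a q n)^-1 - 1| <= C * `|a|) /\
    (`|qpoch_inf a q - 1| <= C * `|a| /\ `|(qpoch_inf a q)^-1 - 1| <= C * `|a|).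
Proof.
move=> /andP[r0 r1].
have r1' : 0 < (1 - rho)^-1 by rewrite invr_gt0 subr_gt0.
have hc K := prod_const_ge0 K hq.
exists (prod_const `|q| 1 + prod_const `|q| (1 - rho)^-1 / (1 - rho)).
  by rewrite addr_ge0// mulr_ge0// ltW.
move=> a ha.
have h1 : 0 <= `|a| <= 1 by rewrite normr_ge0 (le_trans ha)// ltW.
have h2 : 0 <= `|a| / (1 - rho) <= (1 - rho)^-1.
  by rewrite divr_ge0 ?subr_ge0 ?(ltW r1)//= ler_piMl ?(ltW r1')//; case/andP: h1.
have g1 := geom_close_qpoch a; have g2 := geom_close_qpochV ha r1.
have w1 y : y <= prod_const `|q| 1 * `|a| ->
    y <= (prod_const `|q| 1 + prod_const `|q| (1 - rho)^-1 / (1 - rho)) * `|a|.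
  move=> /le_trans; apply; rewrite ler_wpM2r// lerDl mulr_ge0// ltW//.
have w2 y : y <= prod_const `|q| (1 - rho)^-1 * (`|a| / (1 - rho)) ->
    y <= (prod_const `|q| 1 + prod_const `|q| (1 - rho)^-1 / (1 - rho)) * `|a|.
  move=> /le_trans; apply; rewrite mulrCA mulrC ler_wpM2r// lerDr//.
split=> [n|]; split.
- by apply: w1; exact: (geom_close_prod n q01 h1 g1).
- by apply: w2; rewrite /qpoch -prodfV; exact: (geom_close_prod n q01 h2 g2).
- by apply: w1; exact: (geom_close_infprod q01 h1 g1).
- apply: w2; rewrite /qpoch_inf -(infprodV q01 g1 g2).
    exact: (geom_close_infprod q01 h2 g2).
  by move=> k; apply: sub1_mulXn_neq0 => //; exact: le_lt_trans r1.
Qed.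

(** In the cosine expansion, the weights for the parameter s are those for the
    parameter 0 times (s)_k (s)_{n-k} / (s^2)_n, which is 1 + O(|s|) uniformly
    in k and n. The factor n + 1 counts the terms. *)
Lemma nrogers_bound rho : 0 <= rho < 1 -> exists2 C, 0 <= C &
  forall s x n, `|s| <= rho -> Sq q x ->
    `|nrogers s q n x - nrogers 0 q n x| <= C * n.+1%:R * `|s| /\
    `|nrogers s q n x| <= C * n.+1%:R.
Proof.
move=> hr; have [r0 r1] := andP hr.
have [Cq Cq0 hCq] := qpoch_near q01.
have [Cs Cs0 hCs] := qpoch_near hr.
have bound1 y C' : `|y - 1| <= C' * `|q| -> `|y| <= 1 + C' * `|q|.
  move=> h; have -> : y = 1 + (y - 1) by ring.
  by rewrite (le_trans (ler_normD _ _))// normr1 lerD2l.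
pose B : R := 1 + Cq * `|q|.
have B0 : 0 <= B by rewrite addr_ge0// mulr_ge0.
have hB n : `|qpoch q q n| <= B /\ `|(qpoch q q n)^-1| <= B.
  by have [] := (hCq q (lexx _)).1 n => ? ?; split; exact: bound1.
(* the constants that [near1M] gives, first for (s)_k (s)_(n-k), then for its
     quotient by (s^2)_n *)
pose C1 := Cs + Cs + Cs * Cs; pose C2 := C1 + Cs + C1 * Cs.
have C10 : 0 <= C1 by rewrite /C1 !addr_ge0// mulr_ge0.
have C20 : 0 <= C2 by rewrite /C2 !addr_ge0// mulr_ge0.
have B3 : 0 <= B * B * B by rewrite !mulr_ge0.
have main s th n : `|s| <= rho ->
    `|ntrig_sum q s th n - ntrig_sum q 0 th n| <= B * B * B * C2 * n.+1%:R * `|s| /\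
    `|ntrig_sum q s th n| <= B * B * B * (1 + C2) * n.+1%:R.
  move=> hs; have s1 : 0 <= `|s| <= 1 by rewrite normr_ge0 (le_trans hs)// ltW.
  have s2 : `|s ^+ 2| <= `|s|.
    by rewrite normrX expr2 ler_piMr//; case/andP: s1.
  pose b (k : nat) := qpoch q q n * (qpoch q q k)^-1 * (qpoch q q (n - k))^-1.
  have hb k : `|b k| <= B * B * B.
    by rewrite !normrM !ler_pM ?mulr_ge0 ?(hB _).1 ?(hB _).2.
  pose w (t : R) (k : nat) :=
    qpoch t q k * qpoch t q (n - k) * (qpoch (t ^+ 2) q n)^-1.
  have hw k : `|w s k - 1| <= C2 * `|s|.
    apply: near1M => //; first apply: near1M => //.
    - by have [] := (hCs s hs).1 k.
    - by have [] := (hCs s hs).1 (n - k)%N.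
    - have [_ h] := (hCs (s ^+ 2) (le_trans s2 hs)).1 n.
      by rewrite (le_trans h)// ler_wpM2l.
  have w0 k : w 0 k = 1.
    have p m : qpoch 0 q m = 1.
      by rewrite /qpoch big1// => i _; rewrite mul0r subr0.
    by rewrite /w expr0n/= !p invr1 !mulr1.
  have E t : ntrig_sum q t th n = \sum_(k < n.+1)
      b k * w t k * cos ((n%:R - k%:R *+ 2) * th).
    rewrite /ntrig_sum /trig_sum mulr_sumr; apply: eq_bigr => k _.
    by rewrite /trig_weight /b /w !mulrA; congr (_ * _); ring.
  have cos1 y : `|cos y| <= 1 by rewrite ler_norml cos_geN1 cos_le1.
  have sumc C' : \sum_(k < n.+1) C' = C' * n.+1%:R :> R.
    by rewrite sumr_const card_ord mulr_natr.
  split.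
  - rewrite !E -sumrB.
    have -> : B * B * B * C2 * n.+1%:R * `|s| = B * B * B * (C2 * `|s|) * n.+1%:R.
      by ring.
    rewrite -sumc (le_trans (ler_norm_sum _ _ _))// ler_sum// => k _.
    rewrite w0 -mulrBl -mulrBr normrM (normrM (b k)) -[leRHS]mulr1.
    by apply: ler_pM; rewrite ?mulr_ge0 ?cos1//; apply: ler_pM; rewrite ?hb ?hw.
  - rewrite E -sumc (le_trans (ler_norm_sum _ _ _))// ler_sum// => k _.
    rewrite normrM (normrM (b k)) -[leRHS]mulr1.
    apply: ler_pM; rewrite ?mulr_ge0 ?cos1//; apply: ler_pM; rewrite ?hb//.
    have -> : w s k = 1 + (w s k - 1) by ring.
    rewrite (le_trans (ler_normD _ _))// normr1 lerD2l (le_trans (hw k))//.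
    by rewrite ler_piMr//; case/andP: s1.
exists (B * B * B * (1 + C2)); first by rewrite mulr_ge0// addr_ge0.
move=> s x n hs hx; have [th hth] := Sq_cos hx.
have s1 : `|s| < 1 by exact: le_lt_trans r1.
rewrite !(nrogers_trig n hq _ hth) ?normr0//.
have [h1 h2] := main s th n hs; split=> //.
apply: (le_trans h1); rewrite !ler_wpM2r//; rewrite ler_wpM2l// lerDr//.
Qed.

(** * The Rogers density as a function of its parameter *)

Lemma lq_neq0 x a : Sq q x -> `|a| < 1 -> lq q x a != 0.
Proof.
move=> hx ha; rewrite gt_eqF//; apply: lt_le_trans (lq_ge hx (lexx _) ha).
by rewrite exprn_gt0// subr_gt0.
Qed.

Definition lq_inf s x : R := infprod (fun i => lq q x (s * q ^+ i)).

Lemma mulXn_lt1 a n : `|a| < 1 -> `|a * q ^+ n| < 1.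
Proof. by apply: le_lt_trans; exact: norm_mulXn_le. Qed.

Lemma lq_infV x s : Sq q x -> `|s| < 1 ->
  infprod (fun i => (lq q x (s * q ^+ i))^-1) = (lq_inf s x)^-1.
Proof.
move=> hx hs; apply: (infprodV q01 (geom_close_lq hx (ltW hs))).
  exact: (geom_close_lqV hx (lexx _) hs).
by move=> k; apply: lq_neq0 => //; exact: mulXn_lt1.
Qed.

Lemma lq_inf_neq0 x s : Sq q x -> `|s| < 1 -> lq_inf s x != 0.
Proof.
move=> hx hs; apply: (infprod_neq0 q01 (geom_close_lq hx (ltW hs))).
  exact: (geom_close_lqV hx (lexx _) hs).
by move=> k; apply: lq_neq0 => //; exact: mulXn_lt1.
Qed.

Lemma qpoch_inf_neq0 a : `|a| < 1 -> qpoch_inf a q != 0.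
Proof.
move=> ha; apply: (infprod_neq0 q01 (geom_close_qpoch a)).
  exact: (geom_close_qpochV (lexx _) ha).
by move=> k; exact: sub1_mulXn_neq0.
Qed.

Lemma qpoch_inf_recl a : qpoch_inf a q = (1 - a) * qpoch_inf (a * q) q.
Proof.
rewrite {1}/qpoch_inf (infprod_recl q01 (geom_close_qpoch a)) expr0 mulr1.
by congr (_ * infprod _); apply/funext => k; rewrite exprS mulrA.
Qed.

Lemma lq_inf_recl s x : Sq q x -> `|s| < 1 ->
  lq_inf s x = lq q x s * lq_inf (s * q) x.
Proof.
move=> hx hs.
rewrite {1}/lq_inf (infprod_recl q01 (geom_close_lq hx (ltW hs))) expr0 mulr1.
by congr (_ * infprod _); apply/funext => k; rewrite exprS mulrA.
Qed.

Lemma lq_inf_near rho : 0 <= rho < 1 -> exists2 C, 0 <= C &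
  forall s x, `|s| <= rho -> Sq q x ->
    `|lq_inf s x - 1| <= C * `|s| /\ `|(lq_inf s x)^-1 - 1| <= C * `|s|.
Proof.
move=> /andP[r0 r1].
have d0 : 0 < ((1 - rho) ^+ 2)^-1 by rewrite invr_gt0 exprn_gt0 ?subr_gt0.
pose K2 : R := 3 / (1 - rho) ^+ 2.
have K20 : 0 <= K2 by rewrite /K2 mulr_ge0// ltW.
have p1 := prod_const_ge0 3 hq; have p2 := prod_const_ge0 K2 hq.
pose C : R := prod_const `|q| 3 * 3 + prod_const `|q| K2 * K2.
exists C; first by rewrite /C addr_ge0// mulr_ge0.
move=> s x hs hx; have s1 : `|s| <= 1 by rewrite (le_trans hs)// ltW.
have s1' : `|s| < 1 by exact: le_lt_trans r1.
split.
- have h : 0 <= 3 * `|s| <= 3 by rewrite mulr_ge0//= ler_piMr.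
  apply: (le_trans (geom_close_infprod q01 h (geom_close_lq hx s1))).
  by rewrite mulrA ler_wpM2r// /C lerDl mulr_ge0.
- have e : 3 * `|s| / (1 - rho) ^+ 2 = K2 * `|s| by rewrite /K2 mulrAC.
  have h : 0 <= K2 * `|s| <= K2 by rewrite mulr_ge0//= ler_piMr.
  have g := geom_close_lqV hx hs r1; rewrite e in g.
  rewrite -lq_infV//; apply: (le_trans (geom_close_infprod q01 h g)).
  by rewrite mulrA ler_wpM2r// /C lerDr mulr_ge0.
Qed.

Lemma fN_bound : exists2 C, 0 <= C & forall x, Sq q x -> `|fN q x| <= C.
Proof.
have [C C0 hC] := lq_inf_near q01.
pose K := `|qpoch_inf q q * Num.sqrt (1 - q)| * 2 / `|2 * pi|.
have K0 : 0 <= K by rewrite /K !mulr_ge0.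
exists (K * (1 + C)); first by rewrite mulr_ge0// addr_ge0.
move=> x hx; have [h _] := hC q x (lexx _) hx.
have -> : fN q x = qpoch_inf q q * Num.sqrt (1 - q)
    * Num.sqrt (4 - (1 - q) * x ^+ 2) / (2 * pi) * lq_inf q x.
  by rewrite /fN /lq_inf; congr (_ * infprod _); apply/funext => k; rewrite exprS.
rewrite normrM ler_pM//.
- rewrite normrM normfV /K ler_wpM2r ?invr_ge0// normrM ler_wpM2l//.
  rewrite ger0_norm ?sqrtr_ge0//.
  have [h1 h2] := andP (Sq_bounds hx).
  have : Num.sqrt (4 - (1 - q) * x ^+ 2) <= Num.sqrt (2 ^+ 2).
    by apply: ler_wsqrtr; lra.
  by rewrite sqrtr_sqr ger0_norm.
- have -> : lq_inf q x = 1 + (lq_inf q x - 1) by ring.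
  rewrite (le_trans (ler_normD _ _))// normr1 lerD2l (le_trans h)//.
  by rewrite ler_piMr// ltW.
Qed.

Lemma fR_split s x : fR s q x = fN q x *
  (qpoch_inf (s ^+ 2) q * (qpoch_inf s q)^-1 * (qpoch_inf (s * q) q)^-1
   * (lq_inf s x)^-1).
Proof. by rewrite /fR -/(lq_inf s x) !invfM !mulrA. Qed.

(** The four infinite products that turn f_N into f_R are all 1 + O(|s|), so
    f_R is Lipschitz in s at 0, uniformly on the support; the value at 0 is
    f_N. *)
Lemma fR_near rho : 0 <= rho < 1 -> exists2 C, 0 <= C &
  forall s x, `|s| <= rho -> Sq q x ->
    `|fR s q x - fN q x| <= C * `|s| /\ `|fR s q x| <= C.
Proof.
move=> hr; have [r0 r1] := andP hr.
have [Cp Cp0 hCp] := qpoch_near hr.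
have [Cl Cl0 hCl] := lq_inf_near hr.
have [Cf Cf0 hCf] := fN_bound.
pose C1 := Cp + Cp + Cp * Cp; pose C2 := C1 + Cp + C1 * Cp.
pose C3 := C2 + Cl + C2 * Cl.
have C10 : 0 <= C1 by rewrite /C1 !addr_ge0// mulr_ge0.
have C20 : 0 <= C2 by rewrite /C2 !addr_ge0// mulr_ge0.
have C30 : 0 <= C3 by rewrite /C3 !addr_ge0// mulr_ge0.
exists (Cf * (1 + C3)); first by rewrite mulr_ge0// addr_ge0.
move=> s x hs hx.
have s1 : 0 <= `|s| <= 1 by rewrite normr_ge0 (le_trans hs)// ltW.
have s2 : `|s ^+ 2| <= `|s| by rewrite normrX expr2 ler_piMr//; case/andP: s1.
have sq : `|s * q| <= `|s| by rewrite normrM ler_piMr// ltW.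
have key : `|qpoch_inf (s ^+ 2) q * (qpoch_inf s q)^-1 * (qpoch_inf (s * q) q)^-1
   * (lq_inf s x)^-1 - 1| <= C3 * `|s|.
  apply: near1M => //; first apply: near1M => //; first apply: near1M => //.
  - have [_ [h _]] := hCp (s ^+ 2) (le_trans s2 hs).
    by rewrite (le_trans h)// ler_wpM2l.
  - by have [_ []] := hCp s hs.
  - have [_ [_ h]] := hCp (s * q) (le_trans sq hs).
    by rewrite (le_trans h)// ler_wpM2l.
  - by have [] := hCl s x hs hx.
rewrite fR_split; set Q := _ * (lq_inf s x)^-1 in key *; split.
- have -> : fN q x * Q - fN q x = fN q x * (Q - 1) by ring.
  rewrite normrM -mulrA ler_pM ?hCf// (le_trans key)// ler_wpM2r//.
  by rewrite lerDr.
- rewrite normrM ler_pM ?hCf//; have -> : Q = 1 + (Q - 1) by ring.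
  rewrite (le_trans (ler_normD _ _))// normr1 lerD2l (le_trans key)//.
  by rewrite ler_piMr//; case/andP: s1.
Qed.

(** Passing from s to s q drops the first factor of each infinite product,
    and the first two factors of (s^2)_oo. *)
Lemma fR_dilate s x : Sq q x -> `|s| < 1 ->
  fR (s * q) q x =
  lq q x s * ((1 - s * q) / ((1 + s) * (1 - s ^+ 2 * q))) * fR s q x.
Proof.
move=> hx hs.
have hsq : `|s * q| < 1 by have := mulXn_lt1 1 hs; rewrite expr1.
have hsqq : `|s * q * q| < 1 by have := mulXn_lt1 1 hsq; rewrite expr1.
have hs2 := sqr_norm_lt1 hs.
have n1 := onem_neq0 hq hs; have n2 := onep_neq0 hs; have n3 := onem_neq0 hq hsq.
have n4 : 1 - s ^+ 2 * q != 0 by have := sub1_mulXn_neq0 1 hq hs2; rewrite expr1.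
have n5 := qpoch_inf_neq0 hsq; have n6 := qpoch_inf_neq0 hsqq.
have n7 := lq_inf_neq0 hx hsq; have n8 := lq_neq0 hx hs.
rewrite !fR_split (lq_inf_recl hx hs) (qpoch_inf_recl s) (qpoch_inf_recl (s ^+ 2)).
rewrite (qpoch_inf_recl (s ^+ 2 * q)).
rewrite (qpoch_inf_recl (s * q)) in n5 *.
have -> : (s * q) ^+ 2 = s ^+ 2 * q * q by ring.
have -> : 1 - s ^+ 2 = (1 - s) * (1 + s) by ring.
by field; rewrite n1 n2 n3 n4 n6 n7 n8.
Qed.

(** For s = q the product of the l_q(x|q^i) in f_N cancels against the one in
    the denominator. *)
Lemma fR_q x : Sq q x ->
  fR q q x = Num.sqrt (1 - q) / (2 * pi) * Num.sqrt (4 - (1 - q) * x ^+ 2).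
Proof.
move=> hx; rewrite fR_split.
have e : infprod (fun i => lq q x (q ^+ i.+1)) = lq_inf q x.
  by congr infprod; apply/funext => k; rewrite exprS.
have hqq : `|q * q| < 1 by have := mulXn_lt1 1 hq; rewrite expr1.
have n1 := qpoch_inf_neq0 hq; have n2 := qpoch_inf_neq0 hqq.
have n3 := lq_inf_neq0 hx hq.
have p0 : pi != 0 :> R by rewrite gt_eqF// pi_gt0.
rewrite /fN e expr2; move: pi p0 => p p0.
by field; rewrite p0 n1 n2 n3.
Qed.

Lemma measurable_Sq : measurable (Sq q).
Proof. exact: measurable_itv. Qed.

Lemma measurable_infprod (u : R -> nat -> R) K :
  (forall k, measurable_fun (Sq q) (u ^~ k)) ->
  (forall x, Sq q x -> geom_close `|q| K (u x)) ->
  measurable_fun (Sq q) (fun x => infprod (u x)).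
Proof.
move=> mu uK.
apply: (@measurable_fun_cvg _ _ _ _ (fun n x => \prod_(k < n) u x k)).
  by move=> n; apply: measurable_prod => i _; exact: mu.
by move=> x hx; exact: geom_close_cvg q01 (uK x hx).
Qed.

Lemma continuous_lq a : continuous (fun x => lq q x a).
Proof.
move=> x; apply: cvgB; first exact: cvg_cst.
by apply: cvgM; [exact: cvg_cst|exact: exprn_continuous].
Qed.

Lemma measurable_fR s : `|s| < 1 -> measurable_fun (Sq q) (fR s q).
Proof.
move=> hs.
apply: (@eq_measurable_fun _ _ _ _ _ (fun x => qpoch_inf q q * Num.sqrt (1 - q)
  * Num.sqrt (4 - (1 - q) * x ^+ 2) / (2 * pi)
  * infprod (fun i => lq q x (q * q ^+ i))
  * (qpoch_inf (s ^+ 2) q * (qpoch_inf s q)^-1 * (qpoch_inf (s * q) q)^-1)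
  * infprod (fun i => (lq q x (s * q ^+ i))^-1))).
  move=> x /[!inE] hx; rewrite lq_infV// fR_split /fN.
  have -> : infprod (fun i => lq q x (q ^+ i.+1))
      = infprod (fun i => lq q x (q * q ^+ i)).
    by congr infprod; apply/funext => k; rewrite exprS.
  by rewrite !mulrA.
have mlq a : measurable_fun (Sq q) (fun x => lq q x a).
  apply: measurable_funTS; apply: continuous_measurable_fun; exact: continuous_lq.
apply: measurable_funM; last first.
  apply: (measurable_infprod _ (fun x hx => geom_close_lqV hx (lexx _) hs)) => k.
  apply: (@subspace_continuous_measurable_fun _ (Sq q)); first exact: measurable_Sq.
  apply: continuous_in_subspaceT => x /[!inE] hx.
  by apply: cvgV; [apply: lq_neq0 => //; exact: mulXn_lt1|exact: continuous_lq].
apply: measurable_funM => //.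
apply: measurable_funM; last first.
  exact: (measurable_infprod _ (fun x hx => geom_close_lq hx (ltW hq))).
apply: measurable_funM => //; apply: measurable_funM => //.
apply: measurable_funTS; apply: continuous_measurable_fun => x.
apply: continuous_comp; last exact: sqrt_continuous.
apply: cvgB; first exact: cvg_cst.
by apply: cvgM; [exact: cvg_cst|exact: exprn_continuous].
Qed.

End Estimates.

(** * The semicircle case *)

Section SineIntegral.
Context (R : realType).
Implicit Types (th : R) (k n : nat).

Lemma sin_natmul_pi k : sin (k%:R * pi) = 0 :> R.
Proof.
elim: k => [|k IHk]; first by rewrite mul0r sin0.
by rewrite -natr1 mulrDl mul1r sinD sinpi IHk mul0r mulr0 addr0.
Qed.

(** The primitive of cos (k th) that vanishes at 0. *)
Definition cos_prim k th : R := if k is 0%N then th else k%:R^-1 * sin (k%:R * th).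

Lemma is_derive_cos_prim k th : is_derive th 1 (cos_prim k) (cos (k%:R * th)).
Proof.
case: k => [|k]; first by rewrite mul0r cos0; exact: is_derive_id.
have h : is_derive th 1 (fun y : R => k.+1%:R * y) (k.+1%:R).
  by have := is_deriveZ k.+1%:R (is_derive_id th (1 : R)); rewrite /GRing.scale/= mulr1.
have h2 := @is_derive1_comp _ (@sin R) _ th _ _ (is_derive_sin _) h.
have := is_deriveZ (k.+1%:R)^-1 h2.
by rewrite /GRing.scale/= mulrCA mulVf ?pnatr_eq0// mulr1.
Qed.

Lemma integral_sin_sin (c : R) n :
  (\int[lebesgue_measure]_(th in `[0%R, pi])
      (c * (sin (n.+1%:R * th) * sin th))%:E
   = (if n == 0%N then c * (pi / 2) else 0)%:E)%E.
Proof.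
pose F th := c / 2 * (cos_prim n th - cos_prim n.+2 th).
have dF th : is_derive th 1 F (c * (sin (n.+1%:R * th) * sin th)).
  have := is_deriveZ (c / 2) (is_deriveB (is_derive_cos_prim n th)
    (is_derive_cos_prim n.+2 th)).
  move=> /(@is_derive_eq _ _ _ _ _ _ _ _); apply.
  have -> : n%:R * th = n.+1%:R * th - th by rewrite -natr1; ring.
  have -> : n.+2%:R * th = n.+1%:R * th + th by rewrite -[n.+2%:R]natr1; ring.
  by rewrite /GRing.scale/= !cosD cosN sinN; field.
have cF : continuous F.
  by move=> th; apply/differentiable_continuous/derivable1_diffP; case: (dF th).
rewrite (@continuous_FTC2 _ _ F).
- have e k : cos_prim k (0 : R) = 0.
    by case: k => [//|k]; rewrite /cos_prim mulr0 sin0 mulr0.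
  have e' k : cos_prim k (pi : R) = if k == 0%N then pi else 0.
    by case: k => [//|k]; rewrite /cos_prim sin_natmul_pi mulr0.
  rewrite -EFinB /F !e !e' /= !subr0 mulr0 subr0.
  by case: eqP => _; rewrite ?mulr0// mulrAC mulrA.
- by rewrite pi_gt0.
- apply: continuous_subspaceT => th.
  apply: cvgM; first exact: cvg_cst.
  apply: cvgM; last exact: continuous_sin.
  apply: continuous_comp; last exact: continuous_sin.
  by apply: cvgM; [exact: cvg_cst|exact: cvg_id].
- split=> [th _| |].
  + by case: (dF th).
  + by apply: cvg_at_right_filter; exact: cF.
  + by apply: cvg_at_left_filter; exact: cF.
- by move=> th _; rewrite derive1E; case: (dF th).
Qed.

End SineIntegral.

Section Semicircle.
Context (R : realType) (q : R).
Hypothesis hq : `|q| < 1.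

Let q1 : 0 < 1 - q.
Proof. by rewrite subr_gt0; apply: le_lt_trans hq; rewrite ler_norm. Qed.

Let tau : R := Num.sqrt (1 - q).
Let tau0 : 0 < tau. Proof. by rewrite sqrtr_gt0. Qed.
Let tau2 : tau ^+ 2 = 1 - q. Proof. by rewrite sqr_sqrtr// ltW. Qed.

(** For s = q the recurrence becomes that of the Chebyshev polynomials of the
    second kind. *)
Lemma nrogers_q_sin (n : nat) (th : R) :
  (1 - q ^+ n.+1) * nrogers q q n (2 / tau * cos th) * sin th
  = (1 - q) * sin (n.+1%:R * th).
Proof.
have ex : Num.sqrt (1 - q) * (2 / tau * cos th) = 2 * cos th.
  by rewrite -/tau; field; rewrite gt_eqF.
move: n; apply: (@rec2_unique _ (cst 1) (cst (2 * cos th)) (cst 1)) => [n|n|n||].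
- by rewrite oner_eq0.
- have := nrogersSS hq hq n (2 / tau * cos th); rewrite ex.
  have -> : q ^+ 2 * q ^+ n.+1 = q ^+ n.+3 by rewrite -exprD.
  rewrite -exprS => h; rewrite /cst !mul1r h; ring.
- rewrite /cst !mul1r mulrCA -mulrBr; congr (_ * _).
  have -> : n.+3%:R * th = n.+2%:R * th + th by rewrite -[n.+3%:R]natr1; ring.
  have -> : n.+1%:R * th = n.+2%:R * th - th by rewrite -[n.+2%:R]natr1; ring.
  by rewrite !sinD cosN sinN; ring.
- by rewrite nrogers0 expr1 mulr1 mul1r.
- rewrite nrogers1// ex; have -> : 1 - q ^+ 2 = (1 - q) * (1 + q) by ring.
  have -> : 2%:R * th = th *+ 2 by rewrite mulr_natl.
  by rewrite sin_mulr2n; field; exact: onep_neq0.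
Qed.

Lemma continuous_nrogers (s : R) n : continuous (nrogers s q n).
Proof. by move=> x; apply: cvgM; [exact: cvg_cst|exact: continuous_horner]. Qed.

(** Substitute x = (2 / sqrt (1 - q)) cos th: the square root in the density
    and the Jacobian give one factor sin th each, and E_n sin th is a multiple
    of sin ((n + 1) th). *)
Lemma integral_nrogers_q n :
  (\int[lebesgue_measure]_(x in Sq q) (nrogers q q n x * fR q q x)%:E
   = (if n == 0%N then 1 else 0 : R)%:E)%E.
Proof.
have pi0 : pi != 0 :> R by rewrite gt_eqF// pi_gt0.
have qn0 : 1 - q ^+ n.+1 != 0 by exact: sub1_Xn_neq0.
pose G (x : R) : R := nrogers q q n x
  * (Num.sqrt (1 - q) / (2 * pi) * Num.sqrt (4 - (1 - q) * x ^+ 2)).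
transitivity (\int[lebesgue_measure]_(x in Sq q) (G x)%:E)%E.
  by apply: eq_integral => x /[!inE] hx; rewrite /G fR_q.
pose F th : R := 2 / tau * cos th.
have dF (th : R) : is_derive th 1 F (2 / tau * - sin th).
  by have := is_deriveZ (2 / tau) (is_derive_cos th).
have F'E : derive1 F = (fun (th : R) => 2 / tau * - sin th).
  by apply/funext => th; rewrite derive1E; case: (dF th).
have cF : continuous F.
  by move=> th; apply/differentiable_continuous/derivable1_diffP; case: (dF th).
have cF' : continuous (derive1 F).
  move=> th; rewrite F'E; apply: cvgM; first exact: cvg_cst.
  by apply: cvgN; exact: continuous_sin.
have -> : Sq q = [set` `[F pi, F 0]].
  by rewrite /F cospi cos0 mulr1 mulrN1.
rewrite integration_by_substitution_decreasing; first last.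
- apply: continuous_subspaceT => x; apply: cvgM; first exact: continuous_nrogers.
  apply: cvgM; first exact: cvg_cst.
  apply: continuous_comp; last exact: sqrt_continuous.
  apply: cvgB; first exact: cvg_cst.
  by apply: cvgM; [exact: cvg_cst|exact: exprn_continuous].
- split=> [th _| |].
  + by case: (dF th).
  + by apply: cvg_at_right_filter; exact: cF.
  + by apply: cvg_at_left_filter; exact: cF.
- by apply: (cvgP (derive1 F _)); apply: cvg_at_left_filter; exact: cF'.
- by apply: (cvgP (derive1 F _)); apply: cvg_at_right_filter; exact: cF'.
- by move=> th _; exact: cF'.
- move=> x y hx hy xy; rewrite /F ltr_pM2l ?divr_gt0//.
  by rewrite ltr_cos.
- by rewrite ltW// pi_gt0.
transitivity (\int[lebesgue_measure]_(th in `[0%R, pi])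
  (2 / pi * ((1 - q) / (1 - q ^+ n.+1)) * (sin (n.+1%:R * th) * sin th))%:E)%E.
  apply: eq_integral => th /[!inE]; rewrite /= in_itv/= => /andP[t0 t1].
  have s0 : 0 <= sin th by rewrite sin_ge0_pi// t0.
  congr EFin; transitivity (G (F th) * - derive1 F th) => //; rewrite F'E /G.
  have -> : 4 - (1 - q) * F th ^+ 2 = (2 * sin th) ^+ 2.
    by rewrite [RHS]exprMn sin2cos2 /F -tau2; field; rewrite gt_eqF.
  rewrite sqrtr_sqr ger0_norm ?mulr_ge0//.
  have := nrogers_q_sin n th; rewrite -/(F th) -/tau => h.
  have -> : sin (n.+1%:R * th)
      = (1 - q ^+ n.+1) * nrogers q q n (F th) * sin th / (1 - q).
    by rewrite h mulrAC divff ?mul1r// gt_eqF.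
  rewrite -/tau; set e := nrogers q q n (F th).
  move: pi pi0 => p p0; have q0 : 1 - q != 0 by rewrite gt_eqF.
  have t0' : tau != 0 by rewrite gt_eqF.
  move: {+}tau t0' => t t0'.
  by field; rewrite p0 qn0 q0 t0'.
rewrite integral_sin_sin; case: eqP => [->|//].
congr EFin; rewrite expr1; move: pi pi0 => p p0.
by field; rewrite p0 gt_eqF.
Qed.

End Semicircle.

(** * Moments of the Rogers density *)

Section Moments.
Context (R : realType) (q : R).
Hypothesis hq : `|q| < 1.
Implicit Types (s r x : R) (n : nat) (g : R -> R) (p : {poly R}).

Notation mu := (@lebesgue_measure R).

Let mS : measurable (Sq q) := measurable_Sq q.

Let muS : (mu (Sq q) < +oo)%E.
Proof. by apply: compact_finite_measure; exact: segment_compact. Qed.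

Lemma integrable_fR g s : continuous g -> `|s| < 1 ->
  mu.-integrable (Sq q) (EFin \o (fun x => g x * fR s q x)).
Proof.
move=> cg hs; apply: measurable_bounded_integrable => //.
  apply: measurable_funM; last exact: measurable_fR.
  by apply: measurable_funTS; exact: continuous_measurable_fun.
have [|C C0 hC] := fR_near hq (_ : 0 <= `|s| < 1); first by rewrite normr_ge0.
have : compact (g @` Sq q).
  apply: continuous_compact; last exact: segment_compact.
  exact: continuous_subspaceT.
move=> /compact_bounded [M [Mr hM]].
pose M1 := `|M| + 1.
have gM x : Sq q x -> `|g x| <= M1.
  move=> hx; apply: (hM M1); last by exists x.
  by rewrite /M1 (le_lt_trans (ler_norm M))// ltrDl.
exists (M1 * C); split; first exact: num_real.
move=> y hy x hx; apply: le_trans (ltW hy).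
rewrite normrM ler_pM ?gM//; by have [] := hC s x (lexx _) hx.
Qed.

Definition fR_int s g : R := \int[mu]_(x in Sq q) (g x * fR s q x).

Lemma fR_intE s g : continuous g -> `|s| < 1 ->
  (\int[mu]_(x in Sq q) (g x * fR s q x)%:E = (fR_int s g)%:E)%E.
Proof.
move=> cg hs; rewrite /fR_int /Rintegral fineK//.
by apply: integrable_fin_num => //; exact: (integrable_fR cg hs).
Qed.

Lemma fR_intB s g1 g2 : continuous g1 -> continuous g2 -> `|s| < 1 ->
  fR_int s (fun x => g1 x - g2 x) = fR_int s g1 - fR_int s g2.
Proof.
move=> c1 c2 hs; rewrite /fR_int -RintegralB//; last 2 first.
- exact: integrable_fR.
- exact: integrable_fR.
by apply: eq_Rintegral => x _; rewrite mulrBl.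
Qed.

Lemma fR_intZ s g c : continuous g -> `|s| < 1 ->
  fR_int s (fun x => c * g x) = c * fR_int s g.
Proof.
move=> c1 hs; rewrite /fR_int -RintegralZl//; last exact: integrable_fR.
by apply: eq_Rintegral => x _; rewrite mulrA.
Qed.

Lemma continuousZ g c : continuous g -> continuous (fun x => c * g x).
Proof. by move=> cg x; apply: cvgM; [exact: cvg_cst|exact: cg]. Qed.

(** [fR_dilate] trades the density for s q against l_q(x|s) times the density
    for s, and [nrogers_contiguous] absorbs l_q(x|s). *)
Lemma fR_int_dilate s n : `|s| < 1 ->
  fR_int s (nrogers s q n) - s * fR_int s (nrogers s q n.+2) =
  (1 - s * q ^+ n.+1) / (1 - s * q) * fR_int (s * q) (nrogers (s * q) q n).
Proof.
move=> hs.
have hsq : `|s * q| < 1 by have := mulXn_lt1 hq 1 hs; rewrite expr1.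
have c t k := @continuous_nrogers _ q t k.
rewrite -(fR_intZ s (c s n.+2) hs) -(fR_intZ _ (c (s * q) n) hsq).
rewrite -(fR_intB (c s n) (continuousZ (c := s) (c s n.+2)) hs).
apply: eq_Rintegral => x /[!inE] hx.
rewrite (fR_dilate hq hx hs) -nrogers_contiguous//.
have n1 := onep_neq0 hs; have n2 := onem_neq0 hq hsq.
have n3 : 1 - s ^+ 2 * q != 0.
  by have := sub1_mulXn_neq0 1 hq (sqr_norm_lt1 hs); rewrite expr1.
by field; rewrite n1 n2 n3.
Qed.

Lemma fR_int_lipschitz rho : 0 <= rho < 1 -> exists2 C, 0 <= C &
  forall s n, `|s| <= rho ->
    `|fR_int s (nrogers s q n) - fR_int 0 (nrogers 0 q n)| <= C * n.+1%:R * `|s|.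
Proof.
move=> hr; have [r0 r1] := andP hr.
have [CE CE0 hE] := nrogers_bound hq hr.
have [Cf Cf0 hf] := fR_near hq hr.
pose m := fine (mu (Sq q)).
have m0 : 0 <= m by rewrite fine_ge0.
exists ((CE * Cf + CE * Cf) * m).
  by rewrite mulr_ge0// addr_ge0// mulr_ge0.
move=> s n hs; have s1 : `|s| < 1 by exact: le_lt_trans r1.
have z1 : `|0 : R| < 1 by rewrite normr0.
have z2 : `|0 : R| <= rho by rewrite normr0.
have c t k := @continuous_nrogers _ q t k.
have i1 := integrable_fR (c s n) s1; have i2 := integrable_fR (c 0 n) z1.
have iB : mu.-integrable (Sq q)
    (EFin \o (fun x => nrogers s q n x * fR s q x - nrogers 0 q n x * fR 0 q x)).
  have -> : EFin \o (fun x => nrogers s q n x * fR s q x - nrogers 0 q n x * fR 0 q x)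
      = ((EFin \o (fun x => nrogers s q n x * fR s q x)%R)
         \- (EFin \o (fun x => nrogers 0 q n x * fR 0 q x)%R))%E by [].
  by apply: integrableB; [|exact: i1|exact: i2].
rewrite /fR_int -RintegralB//.
apply: le_trans; first by apply: le_normr_Rintegral; [exact: mS|exact: iB].
pose K := (CE * Cf + CE * Cf) * n.+1%:R * `|s|.
have -> : (CE * Cf + CE * Cf) * m * n.+1%:R * `|s| = K * m by rewrite /K; ring.
rewrite /m -Rintegral_cst//; apply: le_Rintegral => //.
- exact: integrable_norm iB.
- apply: continuous_compact_integrable; first exact: segment_compact.
  by apply: continuous_subspaceT => x; exact: cvg_cst.
move=> x hx.
have [e1 e2] := hE s x n hs hx; have [_ e3] := hE 0 x n z2 hx.
have [f1 f2] := hf s x hs hx.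
have f0 : fR 0 q x = fN q x.
  apply/eqP; rewrite -subr_eq0 -normr_eq0; apply/eqP/le_anti.
  by have [+ _] := hf 0 x z2 hx; rewrite normr0 mulr0 normr_ge0 => ->.
rewrite f0.
have -> : nrogers s q n x * fR s q x - nrogers 0 q n x * fN q x
  = (nrogers s q n x - nrogers 0 q n x) * fR s q x
    + nrogers 0 q n x * (fR s q x - fN q x) by ring.
apply: (le_trans (ler_normD _ _)).
rewrite (normrM (_ - _)) (normrM (nrogers 0 q n x)).
have -> : K = CE * n.+1%:R * `|s| * Cf + CE * n.+1%:R * (Cf * `|s|).
  by rewrite /K; ring.
by apply: lerD; apply: ler_pM.
Qed.

(** The defect between the two sides satisfies the hypotheses of
    [qdilation_rigidity]: for n = 0 its coefficient in [fR_int_dilate] is 1,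
    which matches the constant subtracted. *)
Lemma fR_int_nrogers s n : `|s| < 1 ->
  fR_int s (nrogers s q n) = if n == 0%N then 1 else 0.
Proof.
pose d s n : R := fR_int s (nrogers s q n) - (if n == 0%N then 1 else 0).
move=> hs; apply/eqP; rewrite -subr_eq0; apply/eqP; rewrite -/(d s n).
apply: (qdilation_rigidity hq) hs => {s n} [s n hs|rho hr|n].
- have := fR_int_dilate n hs; rewrite /d => h.
  have hsq : `|s * q| < 1 by have := mulXn_lt1 hq 1 hs; rewrite expr1.
  rewrite [in RHS]mulrBr -h (_ : (n.+2 == 0%N) = false)//.
  case: (n == 0%N) / eqP => [->|_]; last by ring.
  by rewrite expr1 divff ?(onem_neq0 hq hsq)// subr0 mulr1 addrAC.
- have [C C0 hC] := fR_int_lipschitz hr; exists C => // s n hs.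
  have -> : d s n - d 0 n = fR_int s (nrogers s q n) - fR_int 0 (nrogers 0 q n).
    by rewrite /d opprB addrA subrK.
  exact: hC.
- rewrite /d; apply/eqP; rewrite subr_eq0; apply/eqP/EFin_inj.
  rewrite -fR_intE//; first exact: integral_nrogers_q.
  exact: continuous_nrogers.
Qed.

End Moments.

(** * Orthogonality and uniqueness *)

Section Orthogonality.
Context (R : realType) (q r : R).
Hypotheses (hq : `|q| < 1) (hr : `|r| < 1).
Implicit Types (p : {poly R}) (n m k : nat).

Definition moment (p : {poly R}) : R := fR_int q r (horner p).

Lemma momentE p :
  (\int[lebesgue_measure]_(x in Sq q) (p.[x] * fR r q x)%:E = (moment p)%:E)%E.
Proof. by rewrite fR_intE//; exact: continuous_horner. Qed.

Lemma momentZ c p : moment (c *: p) = c * moment p.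
Proof.
rewrite /moment -fR_intZ//; last exact: continuous_horner.
by congr fR_int; apply/funext => x; rewrite hornerZ.
Qed.

Lemma momentB p1 p2 : moment (p1 - p2) = moment p1 - moment p2.
Proof.
rewrite /moment -fR_intB//; try exact: continuous_horner.
by congr fR_int; apply/funext => x; rewrite hornerD hornerN.
Qed.

Lemma moment0 : moment 0 = 0.
Proof. by rewrite -(subrr (0 : {poly R})) momentB subrr. Qed.

Lemma momentD p1 p2 : moment (p1 + p2) = moment p1 + moment p2.
Proof.
have -> : p1 + p2 = p1 - (0 - p2) by rewrite sub0r opprK.
by rewrite !momentB moment0 sub0r opprK.
Qed.

Notation w := (rogers r q).

Lemma moment_rogers n : moment (w n) = if n == 0%N then 1 else 0.
Proof.
have q1 : 0 < 1 - q by rewrite subr_gt0; apply: le_lt_trans hq; rewrite ler_norm.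
have := fR_int_nrogers hq n hr.
rewrite /nrogers fR_intZ//; last exact: continuous_horner.
rewrite -/(moment (w n)); case: eqP => [->|_].
  by rewrite !qpoch0 divr1 expr0 !mul1r.
move=> /eqP; rewrite mulf_eq0 => /orP[|/eqP//].
rewrite !mulf_eq0 invr_eq0 (negbTE (qpoch_neq0 n hq hr)).
rewrite (negbTE (qpoch_neq0 n hq (sqr_norm_lt1 hr))) !orbF expf_eq0.
by rewrite gt_eqF ?sqrtr_gt0// andbF.
Qed.

Notation lam := (rogers_coef r q).

Lemma mulX_rogersS n : 'X * w n.+1 = w n.+2 + lam n *: w n.
Proof. by rewrite rogersSS subrK. Qed.

(** Induction on m: expressing w_{m+1} by X w_m and moving X over to w_n, all
    terms pair w_m or w_{m-1} with a polynomial of larger index, except for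
    w_m with itself when n = m + 1, which gives the recurrence of the norms. *)
Lemma moment_rogersM n m : (m <= n)%N ->
  moment (w n * w m) = if n == m then \prod_(i < n) lam i else 0.
Proof.
have [k] := ubnP m; elim: k m n => // k IHk [|m] n.
  move=> _ _; rewrite rogers0 mulr1 moment_rogers.
  by case: n => [|n]; rewrite // big_ord0.
rewrite ltnS => mk; case: n => // n; rewrite ltnS => mn.
have e : w n.+1 * w m.+1 = ('X * w n.+1) * w m
    - (if m is j.+1 then lam j *: (w n.+1 * w j) else 0).
  case: m {mk mn} => [|j].
    by rewrite rogers0 rogers1 mulr1 subr0 mulrC.
  by rewrite rogersSS mulrBr scalerAr; congr (_ - _); rewrite mulrCA mulrA.
rewrite e mulX_rogersS momentB mulrDl momentD -scalerAl momentZ.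
rewrite (IHk m n.+2)//; last by rewrite (leq_trans mn)// ltnW.
rewrite (IHk m n)//.
have -> : moment (if m is j.+1 then lam j *: (w n.+1 * w j) else 0) = 0.
  case: m {e} mk mn => [|j] mk mn; first exact: moment0.
  rewrite momentZ (IHk j n.+1 (ltnW mk) (leqW (ltnW mn))).
  by rewrite gtn_eqF ?mulr0//; exact: leqW mn.
rewrite gtn_eqF; last by rewrite ltnS ltnW.
rewrite add0r subr0 eqSS; case: eqP => _; last by rewrite mulr0.
by rewrite [in RHS]big_ord_recr/= mulrC.
Qed.

Lemma rogers_norm n : \prod_(i < n) lam i =
  qfact q n * ((1 - r) * qpoch (r ^+ 2) q n / (qpoch r q n * qpoch r q n.+1)).
Proof.
have f k := sub1_mulXn_neq0 k hq hr.
have p k := qpoch_neq0 k hq hr.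
have f0 := onem_neq0 hq hr.
elim: n => [|n IHn].
  rewrite big_ord0 /qfact big_geq// qpochS !qpoch0 expr0.
  by field.
rewrite big_ord_recr/= IHn /rogers_coef.
have -> : qfact q n.+1 = qfact q n * qint q n.+1 by rewrite /qfact big_nat_recr.
rewrite (qpochS _ _ n.+1) !(qpochS _ _ n).
by field; rewrite !f p.
Qed.

Lemma rogers_norm_neq0 n : \prod_(i < n) lam i != 0.
Proof.
apply/prodf_neq0 => i _; rewrite /rogers_coef qintE//.
have q1 := onem_neq0 hq hq.
rewrite !mulf_neq0 ?invr_neq0 ?mulf_neq0 ?sub1_Xn_neq0 ?sub1_mulXn_neq0//.
exact: sqr_norm_lt1.
Qed.

Lemma rogers_monic_size n : w n \is monic /\ size (w n) = n.+1.
Proof.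
suff [] : (w n \is monic /\ size (w n) = n.+1) /\
          (w n.+1 \is monic /\ size (w n.+1) = n.+2) by [].
elim: n => [|n [IH0 IH1]].
  by rewrite rogers0 rogers1 monic1 size_poly1 monicX size_polyX.
split=> //; rewrite rogersSS.
have [m1 s1] := IH1.
have sX : size ('X * w n.+1) = n.+3.
  by rewrite mulrC size_mulX ?s1// monic_neq0.
have sl : (size (- (lam n *: w n))%R < size ('X * w n.+1)%R)%N.
  by rewrite size_polyN sX (leq_ltn_trans (size_scale_leq _ _))// IH0.2.
rewrite size_polyDl// sX; split=> //.
by rewrite monicE lead_coefDl// -monicE monicMl ?monicX.
Qed.

(** Iterating this expands every polynomial in the w_n. *)
Lemma sub_lead_rogers p n : (size p <= n.+1)%N ->
  exists2 p' : {poly R}, (size p' <= n)%N & p = p`_n *: w n + p'.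
Proof.
move=> sp; exists (p - p`_n *: w n); last by rewrite addrC subrK.
have [mon sw] := rogers_monic_size n.
have s1 : (size (p - p`_n *: w n)%R <= n.+1)%N.
  rewrite (leq_trans (size_polyD _ _))// geq_max sp size_polyN.
  by rewrite (leq_trans (size_scale_leq _ _))// sw.
apply/leq_sizeP => j; rewrite leq_eqVlt => /orP[/eqP <-|nj].
  have wn : (w n)`_n = 1.
    by move: mon; rewrite monicE lead_coefE sw => /eqP.
  by rewrite coefB coefZ wn mulr1 subrr.
by move/leq_sizeP: s1; apply.
Qed.

Lemma moment_lower p k n : (size p <= k)%N -> (k <= n)%N -> moment (p * w n) = 0.
Proof.
elim: k p => [|k IHk] p.
  by rewrite leqn0 size_poly_eq0 => /eqP -> _; rewrite mul0r moment0.
move=> /sub_lead_rogers [p' sp' ->] kn.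
rewrite mulrDl momentD -scalerAl momentZ IHk// ?(ltnW kn)// addr0.
by rewrite (mulrC (w k)) moment_rogersM ?(ltnW kn)// gtn_eqF ?mulr0.
Qed.

(** Test against w_k for the largest k that occurs in the expansion of p: the
    norm of w_k is not zero. *)
Lemma orthogonal_to_lower p n : (size p <= n)%N ->
  (forall k, (k < n)%N -> moment (p * w k) = 0) -> p = 0.
Proof.
elim: n p => [|n IHn] p; first by rewrite leqn0 size_poly_eq0 => /eqP.
move=> /sub_lead_rogers[p' sp' e] h.
have c0 : p`_n = 0.
  have := h n (ltnSn _); rewrite e mulrDl momentD (moment_lower sp')// addr0.
  rewrite -scalerAl momentZ moment_rogersM// eqxx => /eqP.
  by rewrite mulf_eq0 (negbTE (rogers_norm_neq0 n)) orbF -e => /eqP.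
have ep : p = p' by rewrite e c0 scale0r add0r.
apply: IHn; first by rewrite ep.
by move=> k kn; apply: h; exact: ltnW.
Qed.

Lemma monic_orthogonal_rogers (p : nat -> {poly R}) :
  monic_orthogonal (Sq q) (fR r q) p <-> (forall n, p n = w n).
Proof.
have pM p1 p2 : (\int[lebesgue_measure]_(x in Sq q)
    (p1.[x] * p2.[x] * fR r q x)%:E = (moment (p1 * p2))%:E)%E.
  by rewrite -momentE; apply: eq_integral => x _; rewrite hornerM.
split=> [[ms orth] n|pw].
  have [k] := ubnP n; elim: k n => // k IHk n; rewrite ltnS => nk.
  have [[m1 s1] [m2 s2]] := (ms n, rogers_monic_size n).
  apply/eqP; rewrite -subr_eq0; apply/eqP.
  apply: (@orthogonal_to_lower _ n).
    apply/leq_sizeP => j; rewrite leq_eqVlt => /orP[/eqP <-|nj].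
      move: m1 m2; rewrite !monicE !lead_coefE s1 s2 => /eqP e1 /eqP e2.
      by rewrite coefB e1 e2 subrr.
    by rewrite coefB !nth_default ?subrr// ?s1 ?s2.
  move=> j jn; rewrite mulrBl momentB moment_rogersM ?(ltnW jn)// gtn_eqF//.
  rewrite subr0 -(IHk j (leq_trans jn nk)); apply: EFin_inj.
  by rewrite -pM orth//; apply/eqP; rewrite gtn_eqF.
split=> [n|n m nm]; first by rewrite pw; exact: rogers_monic_size.
rewrite !pw pM; wlog mn : n m nm / (m <= n)%N.
  move=> h; have /orP[|] := leq_total m n; first exact: h.
  by rewrite mulrC; apply: h => // e; apply: nm.
by rewrite moment_rogersM//; case: eqP.
Qed.

Lemma integral_rogersM n m :
  (\int[lebesgue_measure]_(x in Sq q)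
     ((w n).[x] * (w m).[x] * fR r q x)%:E)%E
  = (if n == m then \prod_(i < n) lam i else 0)%:E.
Proof.
transitivity (moment (w n * w m))%:E.
  by rewrite -momentE; apply: eq_integral => x _; rewrite hornerM.
congr EFin; case: (leqP m n) => [mn|/ltnW nm]; first exact: moment_rogersM.
by rewrite mulrC moment_rogersM// eq_sym; case: eqP => [->|].
Qed.

End Orthogonality.

Unset Implicit Arguments.
Set Strict Implicit.
Set Printing Implicit Defensive.

Theorem proposition2 (R : realType) (q r : R)
    (hq : `|q| < 1) (hr : `|r| < 1) :
  [/\ forall p : nat -> {poly R},
        monic_orthogonal (Sq q) (fR r q) p <-> (forall n, p n = rogers r q n),
      forall (n : nat) (x : R),
        (rogers r q n).[x] = (ASC x r q n).[x] / qpoch r q n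
    & forall n m : nat,
        (\int[lebesgue_measure]_(x in Sq q)
            ((rogers r q n).[x] * (rogers r q m).[x] * fR r q x)%:E)%E
        = (if n == m
           then qfact q n * ((1 - r) * qpoch (r ^+ 2) q n
                             / (qpoch r q n * qpoch r q n.+1))
           else 0)%:E].
Proof.
split.
- exact: (monic_orthogonal_rogers hq hr).
- by move=> n x; exact: rogers_ASC.
- by move=> n m; rewrite integral_rogersM// rogers_norm.
Qed.
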